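(* Let $\mathbb{T}$ be a time scale with $\inf\mathbb{T}=a\in\mathbb{T}$, $\sup\mathbb{T}=b\in\mathbb{T}$, $a<b$ and $\mathbb{T}\cap(a,b)\neq\emptyset$, and let $I=[a,b]\cap\mathbb{T}$. Let $L:\mathbb{T}\times\mathbb{R}^2\to\mathbb{R}$ be a smooth function, let $u\in\mathbb{R}\setminus\{0\}$ and $\alpha,\beta\in\mathbb{R}$. Consider the problem of minimizing $$\mathcal{L}(y)=\int_a^b L\left(t,(y\circ\xi_u)(t),D\overline{y}(t)(u)\right)d_ut$$ over $y\in C^1_\diamond(I,\mathbb{R})$ subject to $y(a)=\alpha$, $y(b)=\beta$. If $y\in C^1_\diamond(I,\mathbb{R})$ is a weak local minimizer of this problem, then, writing $F(t)=\partial_3L\left(t,(y\circ\xi_u)(t),D\overline{y}(t)(u)\right)$, the derivative from the right of $\overline{F}$ at $t$ in the direction $u$ satisfies $$D\overline{F}(t)(u)=u\cdot\partial_2L\left(t,(y\circ\xi_u)(t),D\overline{y}(t)(u)\right)\qquad\text{for all } t\in I^{\kappa^2}_{\kappa^2}.$$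
   Context: A time scale $\mathbb{T}$ is a nonempty closed subset of $\mathbb{R}$, with forward and backward jump operators $\sigma,\rho$ (with $\sigma(b)=b$, $\rho(a)=a$ when $a=\min\mathbb{T}$, $b=\max\mathbb{T}$) and graininess $\mu(t)=\sigma(t)-t$. $y^\sigma=y\circ\sigma$, $y^\rho=y\circ\rho$; $y^\Delta$, $y^\nabla$ are the delta and nabla derivatives, and $\int\cdot\,\Delta t$, $\int\cdot\,\nabla t$ the delta and nabla integrals, in the standard sense of time scale calculus. $I^\kappa=I\setminus(\rho(b),b]$, $I_\kappa=I\setminus[a,\sigma(a))$, $I^\kappa_\kappa=I^\kappa\cap I_\kappa$; $I^{\kappa^2}=(I^\kappa)^\kappa$, $I_{\kappa^2}=(I_\kappa)_\kappa$, $I^{\kappa^2}_{\kappa^2}=I^{\kappa^2}\cap I_{\kappa^2}$. $C^1_\diamond(I,\mathbb{R})$ is the class of functions $y:I\to\mathbb{R}$ with $y^\Delta$ continuous on $I^\kappa$ and $y^\nabla$ continuous on $I_\kappa$. For a function $f$ on the time scale, $\overline{f}$ is its extension to the corresponding real interval given by $\overline{f}(t)=f(t)$ for $t\in\mathbb{T}$ and $\overline{f}(t)=f(s)+\frac{f(\sigma(s))-f(s)}{\mu(s)}(t-s)$ for $t\in(s,\sigma(s))$, where $s\in\mathbb{T}$ is right-scattered (linear interpolation across gaps). The derivative from the right of $\overline{f}$ at $t$ in the direction $u$ is $D\overline{f}(t)(u)=\lim_{h\to0^+}\frac{\overline{f}(t+hu)-\overline{f}(t)}{h}$, if the limit exists.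 If $f^\Delta(t)$ exists then $D\overline{f}(t)(u)=uf^\Delta(t)$ for $u\ge0$; if $f^\nabla(t)$ exists then $D\overline{f}(t)(u)=uf^\nabla(t)$ for $u\le0$. For $u\in\mathbb{R}$: $d_ut=u\,\Delta t$ if $u\ge0$ and $d_ut=u\,\nabla t$ if $u\le0$; that is, $\int_a^b f(t)\,d_ut$ means $u\int_a^bf(t)\Delta t$ if $u\geq 0$ and $u\int_a^bf(t)\nabla t$ if $u\leq 0$. Also $y\circ\xi_u=u\,(y\circ\sigma)$ if $u\ge0$ and $y\circ\xi_u=u\,(y\circ\rho)$ if $u\le0$. $\partial_iL$ is the partial derivative of $L(\cdot,\cdot,\cdot)$ with respect to its $i$th variable. Norm: $\|y\|_{1,\infty}=\|y^\sigma\|_\infty+\|y^\rho\|_\infty+\|y^\Delta\|_\infty+\|y^\nabla\|_\infty$, where $\|y\|_\infty=\sup_{t\in I^\kappa_\kappa}|y(t)|$. A function $\hat y\in C^1_\diamond(I,\mathbb{R})$ satisfying the boundary conditions $y(a)=\alpha$, $y(b)=\beta$ is a weak local minimizer if there exists $\delta>0$ such that $\mathcal{L}(\hat y)\le\mathcal{L}(y)$ for all $y\in C^1_\diamond(I,\mathbb{R})$ satisfying the boundary conditions and $\|y-\hat y\|_{1,\infty}<\delta$.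
   Formalization: The equation is claimed only at t where F is defined at the next point: for u>0 it excludes t=ρ(b) when ρ(b) is left-dense and ρ(b)<b (there F(b) is undefined, as y^Δ(b) does not exist), and dually t=σ(a) right-dense with a<σ(a) for u<0. *)

(* Defs.v *)
From HB Require Import structures.
From mathcomp Require Import all_boot all_order all_algebra.
From mathcomp Require Import all_classical all_reals all_analysis.
Set Implicit Arguments.
Unset Strict Implicit.
Unset Printing Implicit Defensive.
Import Order.TTheory GRing.Theory Num.Theory.
Import numFieldNormedType.Exports.
Local Open Scope classical_set_scope.
Local Open Scope ring_scope.

(* A compact time scale is a set [T : set R]; a function on it is represented
   by a total [f : R -> R] of which only the values on [T] are ever used. *)

(* sigma, with sigma (max T) = max T *)
Definition fjump (R : realType) (T : set R) (t : R) : R :=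
  if `[< exists2 s, T s & t < s >] then inf [set s | T s /\ t < s] else t.

(* rho, with rho (min T) = min T *)
Definition bjump (R : realType) (T : set R) (t : R) : R :=
  if `[< exists2 s, T s & s < t >] then sup [set s | T s /\ s < t] else t.

(* T^kappa and T_kappa; they are again compact time scales (or empty), so that
   T^{kappa^2} is [kappa_up (kappa_up T)]. *)
Definition kappa_up (R : realType) (T : set R) : set R :=
  T `\` [set t | bjump T (sup T) < t <= sup T].

Definition kappa_dn (R : realType) (T : set R) : set R :=
  T `\` [set t | inf T <= t < fjump T (inf T)].

Definition is_delta (R : realType) (T : set R) (f : R -> R) (t d : R) : Prop :=
  kappa_up T t /\
  forall e, 0 < e -> \forall s \near t, T s ->
    `|f (fjump T t) - f s - d * (fjump T t - s)| <= e * `|fjump T t - s|.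

Definition is_nabla (R : realType) (T : set R) (f : R -> R) (t d : R) : Prop :=
  kappa_dn T t /\
  forall e, 0 < e -> \forall s \near t, T s ->
    `|f (bjump T t) - f s - d * (bjump T t - s)| <= e * `|bjump T t - s|.

Definition delta (R : realType) (T : set R) (f : R -> R) (t : R) : R :=
  xget 0 [set d | is_delta T f t d].

Definition nabla (R : realType) (T : set R) (f : R -> R) (t : R) : R :=
  xget 0 [set d | is_nabla T f t d].

(* Delta and nabla integrals are defined through antiderivatives. *)
Definition delta_int (R : realType) (T : set R) (r s : R) (f : R -> R) : R :=
  xget 0 [set v | exists2 G : R -> R,
    (forall t, kappa_up T t -> is_delta T G t (f t)) & v = G s - G r].

Definition nabla_int (R : realType) (T : set R) (r s : R) (f : R -> R) : R :=
  xget 0 [set v | exists2 G : R -> R,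
    (forall t, kappa_dn T t -> is_nabla T G t (f t)) & v = G s - G r].

Definition C1_diamond (R : realType) (T : set R) (y : R -> R) : Prop :=
  [/\ forall t, kappa_up T t -> exists d, is_delta T y t d,
      {within kappa_up T, continuous (delta T y)},
      forall t, kappa_dn T t -> exists d, is_nabla T y t d
    & {within kappa_dn T, continuous (nabla T y)}].

(* The piecewise linear extension of [f] to the interval [min T, max T]: if [t]
   lies in the gap (s, sigma s), then s = [bjump T t]. *)
Definition bar (R : realType) (T : set R) (f : R -> R) (t : R) : R :=
  if `[< T t >] then f t
  else let s := bjump T t in
       f s + (f (fjump T s) - f s) / (fjump T s - s) * (t - s).

(* [is_Dbar T f t u d]: the derivative from the right of [bar T f] at [t] in the
   direction [u] exists and is [d].  At the endpoints of [T], when [t + h * u]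
   leaves the interval on which [bar T f] lives, the limit makes no sense, and
   the value is the one prescribed by the identities
   D f(t)(u) = u f^Delta(t) (u >= 0) and D f(t)(u) = u f^nabla(t) (u <= 0). *)
Definition is_Dbar (R : realType) (T : set R) (f : R -> R) (t u d : R) : Prop :=
  if `[< ubound T t /\ 0 < u >] then exists2 d', is_delta T f t d' & d = u * d'
  else if `[< lbound T t /\ u < 0 >]
  then exists2 d', is_nabla T f t d' & d = u * d'
  else (bar T f (t + h * u) - bar T f t) / h @[h --> 0^'+] --> d.

Definition Dbar (R : realType) (T : set R) (f : R -> R) (t u : R) : R :=
  xget 0 [set d | is_Dbar T f t u d].

Definition dir_jump (R : realType) (T : set R) (u t : R) : R :=
  if 0 <= u then fjump T t else bjump T t.

(* For y in C^1_diamond, [fun t => Dbar T y t u] is defined exactly on this set. *)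
Definition dir_kappa (R : realType) (T : set R) (u : R) : set R :=
  if 0 <= u then kappa_up T else kappa_dn T.

(* y o xi_u *)
Definition comp_xi (R : realType) (T : set R) (y : R -> R) (u t : R) : R :=
  u * y (dir_jump T u t).

(* the integral with respect to d_u t *)
Definition dir_int (R : realType) (T : set R) (u r s : R) (f : R -> R) : R :=
  if 0 <= u then u * delta_int T r s f else u * nabla_int T r s f.

Definition partial1 (R : realType) (L : R -> R -> R -> R) : R -> R -> R -> R :=
  fun t x v => derive1 (fun s => L s x v) t.
Definition partial2 (R : realType) (L : R -> R -> R -> R) : R -> R -> R -> R :=
  fun t x v => derive1 (fun s => L t s v) x.
Definition partial3 (R : realType) (L : R -> R -> R -> R) : R -> R -> R -> R :=
  fun t x v => derive1 (fun s => L t x s) v.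

Fixpoint Ck (R : realType) (k : nat) (M : R -> R -> R -> R) : Prop :=
  continuous (fun p : R * R * R => M p.1.1 p.1.2 p.2) /\
  if k is k'.+1 then
    (forall t x v, [/\ derivable (fun s => M s x v) t 1,
                       derivable (fun s => M t s v) x 1
                     & derivable (fun s => M t x s) v 1]) /\
    [/\ Ck k' (partial1 M), Ck k' (partial2 M) & Ck k' (partial3 M)]
  else True.

(* Smoothness on the closed set T x R^2, in the usual sense for functions on a
   closed set: [L] is the restriction of a C^infinity function on R^3. *)
Definition smooth_on (R : realType) (T : set R) (L : R -> R -> R -> R) : Prop :=
  exists2 M : R -> R -> R -> R,
    (forall k, Ck k M) & (forall t x v, T t -> L t x v = M t x v).

Definition functional (R : realType) (T : set R) (L : R -> R -> R -> R)
    (u a b : R) (y : R -> R) : R :=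
  dir_int T u a b (fun t => L t (comp_xi T y u t) (Dbar T y t u)).

Definition sup_norm (R : realType) (T : set R) (f : R -> R) : \bar R :=
  ereal_sup [set `|f t|%:E | t in kappa_up T `&` kappa_dn T].

Definition norm1oo (R : realType) (T : set R) (y : R -> R) : \bar R :=
  (sup_norm T (y \o fjump T) + sup_norm T (y \o bjump T)
   + sup_norm T (delta T y) + sup_norm T (nabla T y))%E.

Definition admissible (R : realType) (T : set R) (a b alpha beta : R)
    (y : R -> R) : Prop :=
  [/\ C1_diamond T y, y a = alpha & y b = beta].

Definition weak_local_minimizer (R : realType) (T : set R)
    (L : R -> R -> R -> R) (u a b alpha beta : R) (y : R -> R) : Prop :=
  admissible T a b alpha beta y /\
  exists2 del : R, 0 < del &
    forall z, admissible T a b alpha beta z ->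
      (norm1oo T (fun t => (z t - y t)%R) < del%:E)%E ->
      functional T L u a b y <= functional T L u a b z.

(* Main.v *)
Require Import Defs.
From HB Require Import structures.
From mathcomp Require Import all_boot all_order all_algebra.
From mathcomp Require Import all_classical all_reals all_analysis.
From mathcomp Require Import ring lra.
Set Implicit Arguments.
Unset Strict Implicit.
Unset Printing Implicit Defensive.
Import Order.TTheory GRing.Theory Num.Theory.
Import numFieldNormedType.Exports.
Local Open Scope classical_set_scope.
Local Open Scope ring_scope.

(** The proof is the classical chain: vanishing first variation, integration
    by parts, lemma of du Bois-Reymond.

    Take [u > 0] and write [X], [V] for the second and third arguments of the
    Lagrangian along the minimizer.  If [eta] vanishes at both endpoints and
    has a continuous slope [w], comparing [y] with [y + (c / u) eta] for small
    [c] of both signs shows that the delta integral of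
    [partial2 L * (eta o sigma) + partial3 L * w] is zero
    ([first_variation]).  Let [G] be a delta antiderivative of [partial2 L].
    By the product rule the integral of [(F - G) w] is zero for all these [w],
    hence [F - G] is a constant on T^kappa ([du_bois_reymond]), hence the
    delta derivative of [F] is [partial2 L] wherever [F] is defined
    nearby ([euler_lagrange_integral]); a delta derivative gives the
    derivative of the interpolation in a positive direction
    ([is_Dbar_delta]).  The case [u < 0] is the same statement on the
    reflected time scale [refl T].

    Two ingredients are specific to time scales.

    Antiderivatives.  The integral of a bounded function is constructed in the
    style of Perron, as the infimum of its supersolutions
    ([primitive_exists]): the resulting function obeys the mean value
    estimates on every interval of the time scale, without any measurability
    question, and is an antiderivative as soon as the integrand is
    rd-continuous ([primitive_delta]).  Uniqueness is the mean value
    inequality [delta_mean_value].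

    Test functions.  The antiderivative of [w] is in the class C^1 only if
    both [w] and [w o rho] are continuous, so [w] has to take the same value
    at both ends of every gap whose right end is right-dense.  On a Cantor set
    this leaves only functions like the Cantor staircase.  The lemma
    [step_between] finds enough of them: between two points of the time scale
    with a further point in between, either there is an isolated point, and
    the indicator of the points from there on is allowed, or the dyadic
    numbers of the unit interval embed in an order preserving way into the
    time scale ([dyadic_point]), and the function which sends [x] to the
    supremum of the dyadic numbers placed at or before [x] is continuous and
    constant across all gaps ([staircase]). *)

(** * Jump operators and reflection *)

Record time_scale (R : realType) (T : set R) (a b : R) : Prop := TimeScale {
  ts_closed : closed T;
  ts_min : T a;
  ts_lb : lbound T a;
  ts_max : T b;
  ts_ub : ubound T b;
  ts_lt : a < b }.

(** Reflection exchanges the two jumps, the two derivatives and the two kappa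
    operations, so that every fact about one of them gives the other one. *)
Definition refl (R : realType) (T : set R) : set R := [set t | T (- t)].

Lemma time_scale_refl (R : realType) (T : set R) (a b : R) :
  time_scale T a b -> time_scale (refl T) (- b) (- a).
Proof.
case=> cT Ta la Tb ub ab; split; rewrite /refl /= ?opprK //.
- by apply: preimage_closed cT => x _; exact: opp_continuous.
- by move=> s /= /ub; rewrite lerNl.
- by move=> s /= /la; rewrite lerNr.
- by rewrite ltrN2.
Qed.

Lemma reflK (R : realType) (T : set R) : refl (refl T) = T.
Proof. by rewrite /refl; apply/seteqP; split=> x /=; rewrite opprK. Qed.

Lemma fjump_refl (R : realType) (T : set R) (t : R) :
  fjump (refl T) (- t) = - bjump T t.
Proof.
rewrite /fjump /bjump /refl /=.
have -> : `[< exists2 s, T (- s) & - t < s >] = `[< exists2 s, T s & s < t >].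
  apply/asbool_equiv_eq; split=> -[s Ts st].
    by exists (- s) => //; rewrite ltrNl.
  by exists (- s); rewrite ?opprK // ltrN2.
case: ifP => // _; rewrite /inf; congr (- sup _).
apply/seteqP; split=> [_ [s [Ts st]] <-|s [Ts st]] /=.
  by split=> //; rewrite ltrNl.
by exists (- s); rewrite ?opprK // ltrN2.
Qed.

Lemma bjump_refl (R : realType) (T : set R) (t : R) :
  bjump (refl T) (- t) = - fjump T t.
Proof. by rewrite -{2}[t]opprK -[in RHS](reflK T) fjump_refl opprK. Qed.

Lemma closed_sup (R : realType) (T E : set R) :
  closed T -> E `<=` T -> has_sup E -> T (sup E).
Proof.
move=> cT ET supE; apply: cT => B /nbhs_ballP[e e0 Be].
have [s Es se] := sup_adherent e0 supE.
exists s; split; first exact: ET.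
apply: Be; rewrite /ball /= ger0_norm ?subr_ge0 ?sup_upper_bound //.
by rewrite ltrBlDr -ltrBlDl.
Qed.

Lemma ts_lt_max (R : realType) (T : set R) (a b t : R) :
  time_scale T a b -> T t -> t != b -> t < b.
Proof. by move=> TS Tt tb; rewrite lt_neqAle tb (ts_ub TS). Qed.

Lemma ts_gt_min (R : realType) (T : set R) (a b t : R) :
  time_scale T a b -> T t -> t != a -> a < t.
Proof. by move=> TS Tt ta; rewrite lt_neqAle eq_sym ta (ts_lb TS). Qed.

Section Jumps.
Variables (R : realType) (T : set R) (a b : R).
Hypothesis TS : time_scale T a b.

Let has_sup_below (t s : R) : T s -> s < t -> has_sup [set s | T s /\ s < t].
Proof. by move=> Ts st; split; [exists s|exists t => x [_ /ltW]]. Qed.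

Lemma bjump_le (t : R) : bjump T t <= t.
Proof.
rewrite /bjump; case: ifP => // /asboolP[s Ts st].
by apply: ge_sup; [exists s|move=> x [_ /ltW]].
Qed.

Lemma le_bjump (s t : R) : T s -> s < t -> s <= bjump T t.
Proof.
move=> Ts st; rewrite /bjump ifT; last by apply/asboolP; exists s.
by apply: sup_upper_bound; first exact: has_sup_below st.
Qed.

Lemma bjump_in_gt (t : R) : a < t -> T (bjump T t).
Proof.
move=> at_; have Ta := ts_min TS.
rewrite /bjump ifT; last by apply/asboolP; exists a.
apply: (closed_sup (ts_closed TS)) (has_sup_below Ta at_).
by move=> s [].
Qed.

Lemma bjump_min : bjump T a = a.
Proof.
rewrite /bjump ifF //; apply/asboolP => -[s Ts].
by rewrite ltNge (ts_lb TS).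
Qed.

Lemma bjump_in (t : R) : T t -> T (bjump T t).
Proof.
move=> Tt; have [->|ta] := eqVneq t a; first by rewrite bjump_min; case: TS.
exact/bjump_in_gt/(ts_gt_min TS).
Qed.

Lemma left_dense (t e : R) : a < t -> bjump T t = t -> 0 < e ->
  exists s, [/\ T s, t - e < s & s < t].
Proof.
move=> at_ rt e0; have Ta := ts_min TS.
have := sup_adherent e0 (has_sup_below Ta at_).
have -> : sup [set s | T s /\ s < t] = t.
  by rewrite -{2}rt /bjump ifT //; apply/asboolP; exists a.
by move=> [s [Ts st] tes]; exists s.
Qed.

End Jumps.

Section JumpsRefl.
Variables (R : realType) (T : set R) (a b : R).
Hypothesis TS : time_scale T a b.
Let TS' := time_scale_refl TS.

Lemma fjumpE (t : R) : fjump T t = - bjump (refl T) (- t).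
Proof. by rewrite bjump_refl opprK. Qed.

Lemma fjump_ge (t : R) : t <= fjump T t.
Proof. by rewrite fjumpE lerNr bjump_le. Qed.

Lemma fjump_le (t s : R) : T s -> t < s -> fjump T t <= s.
Proof.
by move=> Ts ts; rewrite fjumpE lerNl le_bjump ?ltrN2 // /refl /= opprK.
Qed.

Lemma fjump_in_lt (t : R) : t < b -> T (fjump T t).
Proof.
by move=> tb; rewrite fjumpE; apply: (bjump_in_gt TS'); rewrite ltrN2.
Qed.

Lemma fjump_in (t : R) : T t -> T (fjump T t).
Proof.
by move=> Tt; rewrite fjumpE; apply: (bjump_in TS'); rewrite /refl /= opprK.
Qed.

Lemma right_dense (t e : R) : t < b -> fjump T t = t -> 0 < e ->
  exists s, [/\ T s, t < s & s < t + e].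
Proof.
move=> tb st e0.
have [||s [Ts ts st']] := left_dense TS' _ _ e0 (t := - t).
- by rewrite ltrN2.
- by rewrite bjump_refl st.
by exists (- s); split=> //; lra.
Qed.

Lemma sup_ts : sup T = b.
Proof.
case: TS => _ _ _ Tb ub _; apply/le_anti/andP; split.
  by apply: ge_sup; first by exists b.
by apply: ub_le_sup => //; exists b.
Qed.

Lemma inf_ts : inf T = a.
Proof.
case: TS => _ Ta lb _ _ _; apply/le_anti/andP; split.
  by apply: ge_inf => //; exists a.
by apply: lb_le_inf; first by exists a.
Qed.

(** Removing (rho b, b] only ever removes the point [b], and does so exactly
    when [b] is left-scattered. *)
Lemma kappa_upE : kappa_up T = [set t | T t /\ (t = b -> bjump T b = b)].
Proof.
rewrite /kappa_up sup_ts; apply/seteqP; split=> t [Tt /= h]; split=> //.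
  move=> tb; apply/eqP; rewrite eq_le bjump_le /= leNgt; apply/negP => rb.
  by apply: h; rewrite tb rb lexx.
move=> /andP[rt tb]; move: tb; rewrite le_eqVlt => /predU1P[tb|tb].
  by move: rt; rewrite (h tb) tb ltxx.
by move: rt; rewrite ltNge (le_bjump Tt tb).
Qed.

Lemma kappa_dnE : kappa_dn T = [set t | T t /\ (t = a -> fjump T a = a)].
Proof.
rewrite /kappa_dn inf_ts; apply/seteqP; split=> t [Tt /= h]; split=> //.
  move=> ta; apply/eqP; rewrite eq_le fjump_ge andbT leNgt; apply/negP => rb.
  by apply: h; rewrite ta rb lexx.
move=> /andP[ta rt]; move: ta; rewrite le_eqVlt => /predU1P[ta|ta].
  by move: rt; rewrite -ta (h (esym ta)) ltxx.
by move: rt; rewrite ltNge (fjump_le Tt ta).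
Qed.

Lemma kappa_up_lt (t : R) : T t -> t < b -> kappa_up T t.
Proof. by move=> Tt tb; rewrite kappa_upE; split=> // /eqP; rewrite lt_eqF. Qed.

Lemma kappa_up_sub : kappa_up T `<=` T. Proof. by move=> t []. Qed.

Lemma kappa_dn_sub : kappa_dn T `<=` T. Proof. by move=> t []. Qed.

Lemma near_kappa_up (t : R) : kappa_up T t ->
  \forall s \near t, T s -> kappa_up T s.
Proof.
rewrite kappa_upE => -[Tt ht].
have [tb|/(ts_lt_max TS Tt) tb] := eqVneq t b.
  by near=> s; move=> Ts; split=> // _; exact: ht.
near=> s => Ts; split=> // sb; suff : s < b by rewrite sb ltxx.
by near: s; apply: lt_nbhsl.
Unshelve. all: by end_near. Qed.

(** This is why delta derivatives are unique on T^kappa: a point that is its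
    own forward jump is there a limit of other points, from the right, or from
    the left if it is [b]. *)
Lemma not_isolated (t e : R) : kappa_up T t -> fjump T t = t -> 0 < e ->
  exists s, [/\ T s, s != t & `|s - t| < e].
Proof.
rewrite kappa_upE => -[Tt ht] st e0.
have [tb|/(ts_lt_max TS Tt) tb] := eqVneq t b.
  have [||s [Ts s1 s2]] := left_dense TS _ _ e0 (t := t).
  - by rewrite tb; case: TS.
  - by rewrite tb; exact: ht.
  by exists s; split=> //; [rewrite lt_eqF|rewrite ltr0_norm; lra].
have [s [Ts s1 s2]] := right_dense tb st e0.
by exists s; split=> //; [rewrite gt_eqF|rewrite gtr0_norm; lra].
Qed.

End JumpsRefl.

Lemma kappa_up_refl (R : realType) (T : set R) (a b : R) :
  time_scale T a b -> kappa_up (refl T) = refl (kappa_dn T).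
Proof.
move=> TS; rewrite (kappa_upE (time_scale_refl TS)) {2}/refl (kappa_dnE TS).
rewrite bjump_refl; apply/seteqP.
split=> t [Tt h]; split=> //= ta; apply: oppr_inj; rewrite ?opprK.
  by rewrite h // -ta opprK.
by rewrite h ?opprK // ta opprK.
Qed.

(** * Calculus of the delta derivative *)

Definition cont_at (R : realType) (T : set R) (f : R -> R) (t : R) : Prop :=
  f s @[s --> within T (nbhs t)] --> f t.

Lemma cont_atP (R : realType) (T : set R) (f : R -> R) (t : R) :
  cont_at T f t <->
  forall e, 0 < e -> \forall s \near t, T s -> `|f t - f s| <= e.
Proof.
rewrite /cont_at cvgrPdist_le; split=> h e e0; have := h e e0;
  by rewrite near_withinE.
Qed.

Section DeltaCalculus.
Variables (R : realType) (T : set R).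
Implicit Types (f g : R -> R) (t d : R).

Lemma near_distP t (P : R -> Prop) : (\forall s \near t, P s) ->
  exists2 e, 0 < e & forall s, `|s - t| < e -> P s.
Proof.
move=> /nbhs_ballP[e e0 h]; exists e => // s st; apply: h.
by rewrite /ball /= distrC.
Qed.

Lemma near_dist_lt t e : 0 < e -> \forall s \near t, `|s - t| < e.
Proof.
by move=> e0; apply/nbhs_ballP; exists e => // s; rewrite /ball /= distrC.
Qed.

(** The derivative at [t] reads its function near [t] and at [fjump T t].
    Functions of interest are meaningful on T^kappa only, so that the jump has
    to stay inside. *)
Lemma is_delta_eq f g t d : kappa_up T (fjump T t) ->
  {near t, forall s, T s -> kappa_up T s} ->
  (forall s, kappa_up T s -> f s = g s) -> is_delta T f t d -> is_delta T g t d.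
Proof.
move=> ks near_k fg [kt h]; split=> // e e0.
move: near_k (h e e0) => /filterS2; apply=> s Ts {}h Tss.
by rewrite -!fg //; [exact: h|exact: Ts].
Qed.

(** The increment [s = t] is allowed in the definition of the derivative and
    gives this exact relation; at a right-dense point it is trivial. *)
Lemma is_delta_scattered f t d : is_delta T f t d ->
  f (fjump T t) - f t = d * (fjump T t - t).
Proof.
move=> [[Tt _] h]; apply/eqP; rewrite -subr_eq0 -normr_le0.
apply/ler_addgt0Pr => e e0; rewrite add0r.
pose M := `|fjump T t - t| + 1.
have M0 : 0 < M by rewrite ltr_wpDl.
have /nbhs_singleton/(_ Tt)/le_trans -> // := h (e / M) (divr_gt0 e0 M0).
by rewrite mulrAC ler_pdivrMr // ler_pM2l // lerDl.
Qed.

Lemma is_delta_cont f t d : is_delta T f t d -> cont_at T f t.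
Proof.
move=> fd; have fs := is_delta_scattered fd; case: fd => _ h.
apply/cont_atP => e e0.
set m := fjump T t in fs h *.
pose M := `|m - t| + 1.
have M0 : 0 < M by rewrite ltr_wpDl.
pose D := `|d| + 1.
have D0 : 0 < D by rewrite ltr_wpDl.
have e1 : 0 < e / 2 / M by rewrite !divr_gt0.
have e2 : 0 < e / 2 / D by rewrite !divr_gt0.
move: (h _ e1) (near_dist_lt t ltr01) (near_dist_lt t e2) => /filterS3; apply.
move=> s {}h s1 s2 Ts; have {}h := h Ts.
have -> : f t - f s = (f m - f s - d * (m - s)) + d * (t - s).
  have -> : f t = f m - d * (m - t) by rewrite -fs; ring.
  by ring.
apply: (le_trans (ler_normD _ _)); rewrite [e]splitr lerD //.
  apply: (le_trans h); rewrite mulrAC ler_pdivrMr // ler_pM2l ?divr_gt0 //.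
  rewrite -[m - s](subrKA t); apply: (le_trans (ler_normD _ _)).
  by rewrite lerD2l distrC ltW.
rewrite normrM distrC.
apply: (@le_trans _ _ (D * (e / 2 / D))); last by rewrite mulrC divfK ?gt_eqF.
by rewrite ler_pM ?normr_ge0 // ?lerDl // ltW.
Qed.

Lemma is_delta_lin f g t d1 d2 c : is_delta T f t d1 -> is_delta T g t d2 ->
  is_delta T (fun s => f s + c * g s) t (d1 + c * d2).
Proof.
move=> [kt h1] [_ h2]; split=> // e e0.
pose D := `|c| + 1.
have D0 : 0 < D by rewrite ltr_wpDl.
have e1 : 0 < e / 2 by rewrite divr_gt0.
have e2 : 0 < e / 2 / D by rewrite !divr_gt0.
move: (h1 _ e1) (h2 _ e2) => /filterS2; apply => s {}h1 {}h2 Ts.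
move: (h1 Ts) (h2 Ts); set m := fjump T t => {}h1 {}h2.
rewrite (_ : _ - _ = (f m - f s - d1 * (m - s))
                   + c * (g m - g s - d2 * (m - s))); last by ring.
apply: (le_trans (ler_normD _ _)); rewrite [e]splitr mulrDl lerD //.
rewrite normrM; apply: (@le_trans _ _ (D * (e / 2 / D * `|m - s|))).
  by rewrite ler_pM ?normr_ge0 // lerDl.
by rewrite mulrA [D * _]mulrC divfK ?gt_eqF.
Qed.

Lemma is_delta_mul f g t d1 d2 : is_delta T f t d1 -> is_delta T g t d2 ->
  is_delta T (fun s => f s * g s) t (d1 * g (fjump T t) + f t * d2).
Proof.
move=> fd gd; have /cont_atP fc := is_delta_cont fd.
case: fd gd => [kt h1] [_ h2]; split=> // e e0.
set m := fjump T t in h1 h2 *.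
(* the sum of the factors of the three error terms below *)
pose D := `|g m| + (`|f t| + 1) + `|d2| + 1.
have D0 : 0 < D by rewrite ltr_wpDl // !addr_ge0.
have e1 : 0 < e / D by rewrite !divr_gt0.
have e2 : 0 < Num.min 1 (e / D) by rewrite lt_min ltr01.
move: (h1 _ e1) (h2 _ e1) (fc _ e2) => /filterS3; apply => s {}h1 {}h2 {}fc Ts.
move: (h1 Ts) (h2 Ts) (fc Ts) => {}h1 {}h2; rewrite le_min => /andP[fc1 fc2].
rewrite (_ : _ - _ = g m * (f m - f s - d1 * (m - s))
   + f s * (g m - g s - d2 * (m - s)) + d2 * - (f t - f s) * (m - s)); last by ring.
apply: (le_trans (ler_normD _ _)).
apply: (@le_trans _ _ (`|g m| * (e / D * `|m - s|)
   + (`|f t| + 1) * (e / D * `|m - s|) + `|d2| * (e / D) * `|m - s|)).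
  rewrite lerD //.
    apply: (le_trans (ler_normD _ _)); rewrite !normrM lerD //.
      by rewrite ler_wpM2l.
    rewrite ler_pM ?normr_ge0 // -[f s](subKr (f t)).
    by apply: (le_trans (ler_normB _ _)); rewrite lerD2l.
  by rewrite !normrM normrN ler_wpM2r // ler_wpM2l.
rewrite (_ : _ + _ = (D - 1) / D * e * `|m - s|); last by rewrite /D; ring.
rewrite ler_wpM2r // -[leRHS]mul1r ler_wpM2r ?(ltW e0) //.
by rewrite ler_pdivrMr // mul1r gerBl.
Qed.

Lemma is_delta_cst t c : kappa_up T t -> is_delta T (fun=> c) t 0.
Proof.
move=> kt; split=> // e e0; near=> s => _.
by rewrite subrr mul0r subr0 normr0 mulr_ge0 // ltW.
Unshelve. all: by end_near. Qed.

Lemma is_delta_id t : kappa_up T t -> is_delta T id t 1.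
Proof.
move=> kt; split=> // e e0; near=> s => _.
by rewrite mul1r subrr normr0 mulr_ge0 // ltW.
Unshelve. all: by end_near. Qed.

Lemma is_delta_dense f t d : kappa_up T t -> fjump T t = t ->
  (forall e, 0 < e -> \forall s \near t, T s ->
    `|f s - f t - d * (s - t)| <= e * `|s - t|) -> is_delta T f t d.
Proof.
move=> kt st h; split=> // e /h /filterS; apply=> s {}h /h; rewrite st.
have -> : f t - f s - d * (t - s) = - (f s - f t - d * (s - t)) by ring.
by rewrite normrN (distrC t).
Qed.

Variables (a b : R).
Hypothesis TS : time_scale T a b.

Lemma is_delta_uniq f t d1 d2 :
  is_delta T f t d1 -> is_delta T f t d2 -> d1 = d2.
Proof.
move=> fd1 fd2; have [st|st] := eqVneq (fjump T t) t; last first.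
  apply: (@mulIf _ (fjump T t - t)); first by rewrite subr_eq0.
  by rewrite -(is_delta_scattered fd1) (is_delta_scattered fd2).
case: fd1 fd2 => kt h1 [_ h2].
apply/eqP; rewrite -subr_eq0 -normr_le0; apply/ler_addgt0Pr => e e0.
rewrite add0r; have e2 : 0 < e / 2 by rewrite divr_gt0.
have [r r0 h] : exists2 r, 0 < r & forall s, `|s - t| < r -> T s ->
    `|(d1 - d2) * (t - s)| <= e * `|t - s|.
  apply: near_distP; move: (h1 _ e2) (h2 _ e2) => /filterS2.
  apply=> s {}h1 {}h2 Ts; move: (h1 Ts) (h2 Ts); rewrite st => {}h1 {}h2.
  rewrite (_ : _ * _ = (f t - f s - d2 * (t - s)) - (f t - f s - d1 * (t - s)));
    last by ring.
  by apply: (le_trans (ler_normB _ _)); rewrite [e]splitr mulrDl lerD.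
have [s [Ts s1 s2]] := not_isolated TS kt st r0.
have := h s s2 Ts; rewrite normrM ler_pM2r // normr_gt0 subr_eq0 eq_sym.
exact: s1.
Qed.

Lemma deltaE f t d : is_delta T f t d -> delta T f t = d.
Proof. by move=> fd; apply: xget_unique => // d' /is_delta_uniq; apply. Qed.

(** One step of induction to the right along the time scale: the linear
    approximation of [f] at [t] is [e]-accurate up to some later point of [T],
    the forward jump if [t] is right-scattered and a nearby point
    otherwise. *)
Lemma is_delta_right f t d e q : is_delta T f t d -> 0 < e -> T q -> t < q ->
  exists x, [/\ T x, t < x, x <= q &
    forall s, T s -> t <= s -> s <= x -> `|f s - f t - d * (s - t)| <= e * (s - t)].
Proof.
move=> fd e0 Tq tq; have Tt := kappa_up_sub (proj1 fd).
suff [x [Tx tx xq hx]] : exists x, [/\ T x, t < x, x <= q &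
    forall s, T s -> t < s -> s <= x -> `|f s - f t - d * (s - t)| <= e * (s - t)].
  exists x; split=> // s Ts; rewrite le_eqVlt => /predU1P[<- _|]; last exact: hx.
  by rewrite !subrr !mulr0 subrr normr0.
have [st|st] := eqVneq (fjump T t) t; last first.
  have ts : t < fjump T t by rewrite lt_neqAle eq_sym st fjump_ge.
  exists (fjump T t); split=> //.
  - exact: (fjump_in TS).
  - exact: fjump_le.
  - move=> s Ts ts' sx; have -> : s = fjump T t.
      by apply/le_anti; rewrite sx fjump_le.
    rewrite (is_delta_scattered fd) subrr normr0.
    by rewrite mulr_ge0 ?ltW // subr_gt0.
have [_ /(_ e e0) /near_distP[r r0 h]] := fd.
have dm0 : 0 < Num.min r (q - t) by rewrite lt_min r0 subr_gt0.
have tb : t < b by rewrite (lt_le_trans tq) // (ts_ub TS).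
have [x [Tx x1 x2]] := right_dense TS tb st dm0.
have xr : x < t + r by apply: (lt_le_trans x2); rewrite lerD2l ge_min lexx.
exists x; split=> //.
  apply/ltW/(lt_le_trans x2).
  by rewrite -lerBrDl ge_min lexx orbT.
move=> s Ts ts sx; have := h s _ Ts; rewrite st.
have -> : f t - f s - d * (t - s) = - (f s - f t - d * (s - t)) by ring.
rewrite normrN (distrC t) gtr0_norm ?subr_gt0 //; apply.
by rewrite ltrBlDl (le_lt_trans sx).
Qed.

(** Induction along the time scale: the supremum of the points up to which
    the bound with constant [C + e] holds satisfies it, by continuity from the
    left or because it is reached, and it can be passed to the right by
    [is_delta_right] unless it is [q]. *)
Lemma delta_mean_value f g C p q :
  (forall t, kappa_up T t -> is_delta T f t (g t)) ->
  T p -> T q -> p <= q -> (forall t, T t -> p <= t -> t < q -> `|g t| <= C) ->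
  `|f q - f p| <= C * (q - p).
Proof.
move=> fg Tp Tq; rewrite le_eqVlt => /predU1P[->|pq] gC.
  by rewrite !subrr normr0 mulr0.
have C0 : 0 <= C by apply: (le_trans (normr_ge0 (g p))); exact: gC.
apply/ler_addgt0Pr => e' e'0; pose e := e' / (q - p).
have e0 : 0 < e by rewrite divr_gt0 ?subr_gt0.
have -> : C * (q - p) + e' = (C + e) * (q - p).
  by rewrite mulrDl /e divfK // gt_eqF ?subr_gt0.
pose P s := `|f s - f p| <= (C + e) * (s - p).
have Pp : P p by rewrite /P !subrr normr0 mulr0.
pose A := [set t | [/\ T t, p <= t, t <= q &
                     forall s, T s -> p <= s -> s <= t -> P s]].
have Ap : A p.
  split=> //; first exact: ltW.
  by move=> s _ ps sp; have -> : s = p by apply/le_anti/andP.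
have supA : has_sup A by split; [exists p|exists q => t []].
have Tm : T (sup A) by apply: closed_sup supA => [|t []]; case: TS.
have [pm mq] : p <= sup A /\ sup A <= q.
  by split; [exact: sup_upper_bound|apply: ge_sup; [exists p|move=> t []]].
set m := sup A in Tm pm mq *.
have Plt s : T s -> p <= s -> s < m -> P s.
  move=> Ts ps sm; have ms0 : 0 < m - s by rewrite subr_gt0.
  have [x [_ _ _ Px]] := sup_adherent ms0 supA.
  by rewrite subKr => /ltW; exact: Px.
have Pm : P m.
  have [->//|/eqP mp] := eqVneq m p.
  have {mp}pm' : p < m by rewrite lt_neqAle pm andbT eq_sym; apply/eqP.
  have [rm|rm] := eqVneq (bjump T m) m; last first.
    have ms0 : 0 < m - bjump T m.
      by rewrite subr_gt0 lt_neqAle rm bjump_le.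
    have [x [Tx px _ Px]] := sup_adherent ms0 supA.
    rewrite subKr => rx; apply: Px => //; rewrite leNgt; apply/negP => xm.
    by move: rx; rewrite ltNge le_bjump.
  have km : kappa_up T m by rewrite (kappa_upE TS); split=> // <-.
  have /cont_atP fc := is_delta_cont (fg m km).
  apply/ler_addgt0Pr => r r0.
  have [d d0 {}fc] := near_distP (fc r r0).
  have dm0 : 0 < Num.min d (m - p) by rewrite lt_min d0 subr_gt0.
  have am : a < m by rewrite (le_lt_trans _ pm') // (ts_lb TS).
  have [x [Tx x1 x2]] := left_dense TS am rm dm0.
  have xd : `|x - m| < d.
    rewrite ltr0_norm ?subr_lt0 // opprB ltrBlDr -ltrBlDl.
    by apply: le_lt_trans x1; rewrite lerD2l lerN2 ge_min lexx.
  have xp : p <= x.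
    apply/ltW/(le_lt_trans _ x1).
    by rewrite lerBrDl -lerBrDr ge_min lexx orbT.
  have := Plt x Tx xp x2; rewrite /P => fx.
  have := fc x xd Tx => fmx.
  have -> : f m - f p = (f x - f p) + (f m - f x) by ring.
  apply: (le_trans (ler_normD _ _)); rewrite lerD //.
  apply: (le_trans fx); rewrite ler_wpM2l ?addr_ge0 ?(ltW e0) //.
  by rewrite lerD2r ltW.
suff qm : q <= m by have <- : m = q by apply/le_anti/andP.
rewrite leNgt; apply/negP => mq'.
have mb : m < b by rewrite (lt_le_trans mq') // (ts_ub TS).
have km := kappa_up_lt TS Tm mb.
have [x [Tx mx xq hx]] := is_delta_right (fg m km) e0 Tq mq'.
suff : A x by move=> Ax; have := sup_upper_bound supA Ax; rewrite leNgt mx.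
split=> //; first exact: le_trans (ltW mx).
move=> s Ts ps sx; have [sm|ms] := leP s m.
  by move: sm; rewrite le_eqVlt => /predU1P[->//|]; exact: Plt.
rewrite /P.
have -> : f s - f p = (f m - f p) + (g m * (s - m) + (f s - f m - g m * (s - m))).
  by ring.
have -> : (C + e) * (s - p) = (C + e) * (m - p) + (C * (s - m) + e * (s - m)).
  by ring.
apply: (le_trans (ler_normD _ _)); rewrite lerD //.
apply: (le_trans (ler_normD _ _)); rewrite lerD ?hx ?(ltW ms) //.
rewrite normrM (gtr0_norm (_ : 0 < s - m)) ?subr_gt0 //.
by rewrite ler_wpM2r ?subr_ge0 ?(ltW ms) // gC.
Qed.

Lemma delta_cst f p q : (forall t, kappa_up T t -> is_delta T f t 0) ->
  T p -> T q -> f p = f q.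
Proof.
move=> f0; wlog pq : p q / p <= q => [hw Tp Tq|Tp Tq].
  by have [/hw->//|/ltW/hw->] := leP p q.
have : `|f q - f p| <= 0 * (q - p).
  by apply: (delta_mean_value f0) => // *; rewrite normr0.
by rewrite mul0r normr_le0 subr_eq0 => /eqP.
Qed.

Lemma delta_intE f g : (forall t, kappa_up T t -> is_delta T f t (g t)) ->
  delta_int T a b g = f b - f a.
Proof.
move=> fg; apply: xget_unique; first by exists f.
move=> v [h hg ->].
have H : forall t, kappa_up T t -> is_delta T (fun s => h s + (-1) * f s) t 0.
  move=> t kt; have := is_delta_lin (-1) (hg t kt) (fg t kt).
  by rewrite mulN1r subrr.
have := delta_cst H (ts_min TS) (ts_max TS); lra.
Qed.

End DeltaCalculus.

(** * Antiderivatives *)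

(** Exactly the two-sided mean value estimate of an indefinite integral of
    [g]; [e = 0] is allowed and gives the increment over a gap. *)
Definition primitive (R : realType) (T : set R) (N g : R -> R) : Prop :=
  forall p q d e, T p -> T q -> p <= q ->
    (forall t, T t -> p <= t -> t < q -> `|g t - d| <= e) ->
    `|N q - N p - d * (q - p)| <= e * (q - p).

Definition supersolution (R : realType) (T : set R) (g f : R -> R) : Prop :=
  forall p q m, T p -> T q -> p <= q ->
    (forall t, T t -> p <= t -> t < q -> m <= g t) -> m * (q - p) <= f q - f p.

Section Primitive.
Variables (R : realType) (T : set R) (a b : R).
Hypothesis TS : time_scale T a b.

(** Where [g <= M], slope [M] is enough for a supersolution, so the graph of
    [f] between [p] and [q] can be replaced by a line of slope [M].  The
    formula with minima and maxima writes the three pieces at once. *)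
Lemma supersolution_glue (g f : R -> R) (p q M : R) : T p -> T q -> p <= q ->
  (forall t, T t -> p <= t -> t < q -> g t <= M) -> supersolution T g f ->
  supersolution T g (fun t => f (Num.min t p) +
    M * (Num.max p (Num.min t q) - p) + (f (Num.max t q) - f q)).
Proof.
move=> Tp Tq pq gM sf r s m Tr Ts rs mg.
have Tmin x y : T x -> T y -> T (Num.min x y) by rewrite minEle; case: ifP.
have Tmax x y : T x -> T y -> T (Num.max x y) by rewrite maxEle; case: ifP.
have h1 : m * (Num.min s p - Num.min r p) <= f (Num.min s p) - f (Num.min r p).
  apply: sf; [exact: Tmin|exact: Tmin| |].
    by rewrite le_min !ge_min rs lexx orbT.
  move=> t Tt; rewrite ge_min lt_min => /orP[rt|pt] /andP[ts tp]; last lra.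
  exact: mg.
have h2 : m * (Num.max s q - Num.max r q) <= f (Num.max s q) - f (Num.max r q).
  apply: sf; [exact: Tmax|exact: Tmax| |].
    by rewrite ge_max !le_max rs lexx orbT.
  move=> t Tt; rewrite ge_max lt_max => /andP[rt qt] /orP[ts|tq]; last lra.
  exact: mg.
have h3 : m * (Num.max p (Num.min s q) - Num.max p (Num.min r q)) <=
          M * (Num.max p (Num.min s q) - Num.max p (Num.min r q)).
  set u := Num.max p (Num.min r q); set v := Num.max p (Num.min s q).
  have Tu : T u by apply: Tmax => //; apply: Tmin.
  have : u <= v.
    rewrite /u /v; case: (leP r q) => ?; case: (leP s q) => ?;
    case: (leP p r) => ?; case: (leP p s) => ?; case: (leP p q) => ?; lra.
  rewrite le_eqVlt => /predU1P[->|uv]; first by rewrite subrr !mulr0.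
  rewrite ler_pM2r ?subr_gt0 //.
  move: uv; rewrite /v lt_max lt_min.
  have pu : p <= u by rewrite le_max lexx.
  rewrite ltNge pu /= => /andP[us uq].
  apply: (@le_trans _ _ (g u)); last exact: gM.
  apply: mg => //; move: uq; rewrite /u le_max le_min gt_max gt_min ltxx orbF.
  by move=> /andP[_ rq]; rewrite lexx (ltW rq) orbT.
have minmax x : Num.min x p + Num.max p (Num.min x q) + Num.max x q = x + p + q.
  by case: (leP x p) => ?; case: (leP x q) => ?; case: leP => ?; lra.
have := minmax s; have := minmax r => e1 e2.
have -> : s - r = (Num.min s p - Num.min r p) +
  (Num.max p (Num.min s q) - Num.max p (Num.min r q)) +
  (Num.max s q - Num.max r q) by lra.
rewrite !mulrDr; lra.
Qed.

(** The infimum [N] of the supersolutions that vanish at [a].  It is a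
    supersolution itself, which is the lower estimate.  If [g <= M] between [p]
    and [q], gluing a line of slope [M] to a supersolution that is nearly
    optimal at [p] gives a competitor at [q], which is the upper estimate. *)
Lemma primitive_exists (g : R -> R) (C : R) :
  (forall t, T t -> t < b -> `|g t| <= C) -> exists N, primitive T N g.
Proof.
move=> gC; have Ta := ts_min TS.
have C0 : 0 <= C by apply: le_trans (normr_ge0 _) (gC _ Ta (ts_lt TS)).
pose S t := [set f t | f in [set f | supersolution T g f /\ f a = 0]].
have lbS t : T t -> lbound (S t) (- C * (t - a)).
  move=> Tt _ [f [sf fa] <-]; rewrite -[leRHS]subr0 -fa.
  apply: sf => // [|s Ts _ st]; first exact: (ts_lb TS).
  by have /gC/(_ (lt_le_trans st (ts_ub TS Tt))) := Ts; rewrite ler_norml => /andP[].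
have infS t : T t -> has_inf (S t).
  move=> Tt; split; last by exists (- C * (t - a)); exact: lbS.
  exists (C * (t - a)); exists (fun s => C * (s - a)) => //; split; last first.
    by rewrite subrr mulr0.
  move=> p q m Tp Tq; rewrite le_eqVlt => /predU1P[->|pq] mg.
    by rewrite !subrr mulr0.
  rewrite -mulrBr [leRHS](_ : _ = C * (q - p)); last by congr (_ * _); ring.
  rewrite ler_pM2r ?subr_gt0 //.
  apply: le_trans (mg p Tp (lexx _) pq) _.
  have /gC/(_ (lt_le_trans pq (ts_ub TS Tq))) := Tp.
  by rewrite ler_norml => /andP[].
pose N t := inf (S t).
have NS t f : T t -> supersolution T g f -> f a = 0 -> N t <= f t.
  by move=> Tt sf fa; apply: ge_inf; [case: (infS t Tt)|exists f].
have Na : N a = 0.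
  apply/le_anti/andP; split; last first.
    apply: lb_le_inf; first by case: (infS a Ta).
    by move=> _ [f [_ fa] <-]; rewrite fa.
  have [[_ [f [sf fa] _]] _] := infS a Ta.
  by rewrite -fa; exact: NS.
exists N => p q d e Tp Tq pq gd.
rewrite ler_distl; apply/andP; split.
  suff : N p + (d - e) * (q - p) <= N q by rewrite mulrBl; lra.
  apply: lb_le_inf; first by case: (infS q Tq).
  move=> _ [f [sf fa] <-].
  have h1 := NS p f Tp sf fa.
  have : (d - e) * (q - p) <= f q - f p.
    by apply: sf => // t Tt pt tq; have := gd t Tt pt tq; rewrite ler_distl => /andP[].
  lra.
apply/ler_addgt0Pr => r r0.
have [_ [f [sf fa] <-]] := inf_adherent r0 (infS p Tp).
rewrite -/(N p) => fp.
pose M := d + e.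
have gM t : T t -> p <= t -> t < q -> g t <= M.
  by move=> Tt pt tq; have := gd t Tt pt tq; rewrite ler_distl => /andP[].
have := NS q _ Tq (supersolution_glue Tp Tq pq gM sf).
have ap : a <= p := ts_lb TS Tp.
have aq : a <= q := ts_lb TS Tq.
rewrite (min_l ap) (min_l aq) (max_l ap) (max_r aq) fa.
rewrite (min_r pq) minxx (max_r pq) maxxx !subrr mulr0 !addr0 => /(_ erefl).
rewrite /M mulrDl; lra.
Qed.

Lemma primitive_lipschitz (g N : R -> R) (C p q : R) : primitive T N g ->
  (forall t, T t -> t < b -> `|g t| <= C) -> T p -> T q ->
  `|N q - N p| <= C * `|q - p|.
Proof.
move=> prim gC; wlog pq : p q / p <= q => [hw Tp Tq|Tp Tq].
  by have [/hw->//|/ltW/hw h] := leP p q; rewrite distrC (distrC q) h.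
have := @prim p q 0 C Tp Tq pq; rewrite mul0r subr0 (ger0_norm (_ : 0 <= q - p)).
  by apply=> t Tt pt tq; rewrite subr0 gC // (lt_le_trans tq) // (ts_ub TS).
by rewrite subr_ge0.
Qed.

Lemma primitive_dense (g N : R -> R) (t e : R) : primitive T N g ->
  cont_at T g t -> T t -> 0 < e ->
  \forall s \near t, T s -> `|N s - N t - g t * (s - t)| <= e * `|s - t|.
Proof.
move=> prim /cont_atP gt_ Tt e0.
have [r r0 h] := near_distP (gt_ e e0).
apply: filterS (near_dist_lt t r0) => s sr Ts.
have [ts|/ltW st] := leP t s.
  rewrite (ger0_norm (_ : 0 <= s - t)) ?subr_ge0 //; apply: prim => //.
  move=> x Tx tx xs; rewrite distrC; apply: h => //.
  apply: le_lt_trans sr; rewrite !ger0_norm ?subr_ge0 // lerD2r; exact: ltW.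
rewrite (_ : _ - _ = - (N t - N s - g t * (t - s))); last by ring.
rewrite normrN (distrC s) (ger0_norm (_ : 0 <= t - s)) ?subr_ge0 //.
apply: prim => // x Tx sx xt; rewrite distrC; apply: h => //.
apply: le_lt_trans sr; rewrite distrC (distrC s) !ger0_norm ?subr_ge0 //.
  by rewrite lerD2l lerN2.
exact: ltW.
Qed.

Lemma primitive_gap (g N : R -> R) (t : R) : primitive T N g -> T t ->
  N (fjump T t) - N t = g t * (fjump T t - t).
Proof.
move=> prim Tt; apply/eqP; rewrite -subr_eq0 -normr_le0.
have := @prim t (fjump T t) (g t) 0 Tt (fjump_in TS Tt) (fjump_ge _ _).
rewrite mul0r; apply=> s Ts ts st; suff -> : s = t by rewrite subrr normr0.
apply/le_anti; rewrite ts andbT leNgt; apply/negP => /(fjump_le Ts).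
by rewrite leNgt st.
Qed.

(** Both derivatives at a scattered point: [u] is the jump of [t], and a
    Lipschitz function whose increment from [t] to [u] has slope [d] is
    approximated by that slope, since the error is of the order of [s - t]
    while [u - s] stays away from zero. *)
Lemma near_jump_estimate (N : R -> R) (C t u d e : R) : u != t -> 0 < e ->
  (forall s, T s -> `|N s - N t| <= C * `|s - t|) -> N u - N t = d * (u - t) ->
  {near t, forall s, T s -> `|N u - N s - d * (u - s)| <= e * `|u - s|}.
Proof.
move=> ut e0 NC Nu.
have m0 : 0 < `|u - t| by rewrite normr_gt0 subr_eq0.
pose D := `|C| + `|d| + e + 1.
have D0 : 0 < D by rewrite ltr_wpDl // !addr_ge0 // ltW.
have r0 : 0 < e * `|u - t| / D by rewrite divr_gt0 ?mulr_gt0.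
apply: filterS (near_dist_lt t r0) => s; rewrite ltr_pdivlMr // => st Ts.
have -> : N u - N s - d * (u - s) = d * (s - t) - (N s - N t).
  by rewrite (_ : N u = N t + d * (u - t)); [ring|rewrite -Nu; ring].
apply: (le_trans (ler_normB _ _)); rewrite normrM.
have h1 : `|u - t| <= `|u - s| + `|s - t|.
  by rewrite -[u - t](subrKA s) ler_normD.
have h2 := NC s Ts.
have h3 : C * `|s - t| <= `|C| * `|s - t| by rewrite ler_wpM2r // ler_norm.
have h4 : e * `|u - t| <= e * `|u - s| + e * `|s - t|.
  by rewrite -mulrDr ler_pM2l.
have h5 := normr_ge0 (s - t).
move: st; rewrite /D !mulrDr mulr1 ![`|s - t| * _]mulrC; lra.
Qed.

Lemma primitive_delta (g N : R -> R) (C t : R) : primitive T N g ->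
  (forall t, T t -> t < b -> `|g t| <= C) ->
  (fjump T t = t -> cont_at T g t) -> kappa_up T t -> is_delta T N t (g t).
Proof.
move=> prim gC gc kt; have Tt := kappa_up_sub kt.
have [st|st] := eqVneq (fjump T t) t.
  by apply: is_delta_dense => // e e0; apply: primitive_dense => //; exact: gc.
split=> // e e0; apply: near_jump_estimate st e0 _ _; last exact: primitive_gap.
by move=> s Ts; apply: primitive_lipschitz gC _ _.
Qed.

(** The nabla derivative is the value of the integrand at the backward jump;
    hence the second requirement in the definition of [slope]. *)
Lemma primitive_nabla (g N : R -> R) (C t : R) : primitive T N g ->
  (forall t, T t -> t < b -> `|g t| <= C) ->
  (bjump T t = t -> cont_at T g t) -> kappa_dn T t ->
  is_nabla T N t (g (bjump T t)).
Proof.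
move=> prim gC gc kt; have Tt := kappa_dn_sub kt; split=> // e e0.
have [rt|rt] := eqVneq (bjump T t) t.
  rewrite rt; apply: filterS (primitive_dense prim (gc rt) Tt e0) => s + Ts.
  move=> /(_ Ts); rewrite (distrC t).
  by rewrite (_ : _ - _ - _ = - (N t - N s - g t * (t - s))) ?normrN //; ring.
apply: near_jump_estimate (rt) e0 _ _.
  by move=> s Ts; apply: primitive_lipschitz gC _ _.
have Tr := bjump_in TS Tt.
have rt' : bjump T t < t by rewrite lt_neqAle rt bjump_le.
have sr : fjump T (bjump T t) = t.
  apply/le_anti; rewrite fjump_le //= leNgt; apply/negP => srt.
  have := le_bjump (fjump_in TS Tr) srt => srr.
  have sE : fjump T (bjump T t) = bjump T t by apply/le_anti; rewrite srr fjump_ge.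
  have tr0 : 0 < t - bjump T t by rewrite subr_gt0.
  have rb : bjump T t < b := lt_le_trans rt' (ts_ub TS Tt).
  have [s [Ts s1 s2]] := right_dense TS rb sE tr0.
  by move: s1; rewrite ltNge le_bjump //; lra.
have := primitive_gap prim Tr; rewrite sr => h.
by rewrite -[LHS]opprB h; ring.
Qed.

End Primitive.

(** * The nabla derivative and the class C^1 *)

Lemma within_contP (R : realType) (A : set R) (f : R -> R) :
  {within A, continuous f} <-> forall t, A t -> cont_at A f t.
Proof. exact: subspace_continuousP. Qed.

Lemma cont_at_near (R : realType) (A B : set R) (f : R -> R) (t : R) :
  {near t, forall s, A s -> B s} -> cont_at B f t -> cont_at A f t.
Proof.
move=> AB /cont_atP fB; apply/cont_atP => e /fB.
by move: AB => /filterS2; apply => s h + /h.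
Qed.

Lemma cont_at_eq (R : realType) (A : set R) (f g : R -> R) (t : R) :
  (forall s, A s -> f s = g s) -> A t -> cont_at A f t -> cont_at A g t.
Proof.
move=> fg At /cont_atP fc; apply/cont_atP => e /fc; apply: filterS => s h As.
by rewrite -!fg //; exact: h.
Qed.

Section C1.
Variables (R : realType) (T : set R) (a b : R).
Hypothesis TS : time_scale T a b.
Let TS' := time_scale_refl TS.
Implicit Types (f g w y : R -> R) (t d : R).

Lemma is_nabla_refl f t d :
  is_nabla T f t d <-> is_delta (refl T) (f \o -%R) (- t) (- d).
Proof.
rewrite /is_nabla /is_delta (kappa_up_refl TS) {1}/refl /= opprK.
have E s : f (- fjump (refl T) (- t)) - f (- s) - - d * (fjump (refl T) (- t) - s)
   = f (bjump T t) - f (- s) - d * (bjump T t - - s).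
  by rewrite fjump_refl opprK; ring.
have E' s : `|fjump (refl T) (- t) - s| = `|bjump T t - - s|.
  by rewrite fjump_refl -(normrN (- _ - _)) opprD !opprK.
split=> -[kt h]; split=> // e e0.
  have [r r0 {}h] := near_distP (h e e0).
  apply: filterS (near_dist_lt (- t) r0) => s sr Ts; rewrite E E'; apply: h => //.
  by rewrite -normrN opprD opprK; move: sr; rewrite opprK.
have [r r0 {}h] := near_distP (h e e0).
apply: filterS (near_dist_lt t r0) => s sr Ts.
have := h (- s); rewrite E E' !opprK; apply; last by rewrite /refl /= opprK.
by rewrite -normrN opprD opprK.
Qed.

Lemma is_nabla_lin f g t d1 d2 c : is_nabla T f t d1 -> is_nabla T g t d2 ->
  is_nabla T (fun s => f s + c * g s) t (d1 + c * d2).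
Proof.
move=> /is_nabla_refl fd /is_nabla_refl gd; apply/is_nabla_refl.
have := is_delta_lin c fd gd; congr is_delta; ring.
Qed.

Lemma is_nabla_uniq f t d1 d2 :
  is_nabla T f t d1 -> is_nabla T f t d2 -> d1 = d2.
Proof.
by move=> /is_nabla_refl h1 /is_nabla_refl/(is_delta_uniq TS' h1)/oppr_inj.
Qed.

Lemma nablaE f t d : is_nabla T f t d -> nabla T f t = d.
Proof. by move=> fd; apply: xget_unique => // d' /is_nabla_uniq; apply. Qed.

Lemma C1_intro f v n :
  (forall t, kappa_up T t -> is_delta T f t (v t)) ->
  {within kappa_up T, continuous v} ->
  (forall t, kappa_dn T t -> is_nabla T f t (n t)) ->
  {within kappa_dn T, continuous n} -> C1_diamond T f.
Proof.
move=> fv vc fn nc; split.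
- by move=> t /fv; exists (v t).
- apply/within_contP => t kt; move/within_contP/(_ t kt): vc.
  by apply: cont_at_eq => // s /fv/(deltaE TS).
- by move=> t /fn; exists (n t).
- apply/within_contP => t kt; move/within_contP/(_ t kt): nc.
  by apply: cont_at_eq => // s /fn/nablaE.
Qed.

Lemma C1_delta y t : C1_diamond T y -> kappa_up T t ->
  is_delta T y t (delta T y t).
Proof. by move=> [h _ _ _] /h; exact: xgetPex. Qed.

Lemma C1_nabla y t : C1_diamond T y -> kappa_dn T t ->
  is_nabla T y t (nabla T y t).
Proof. by move=> [_ _ h _] /h; exact: xgetPex. Qed.

Lemma cont_at_lin A f g t c : cont_at A f t -> cont_at A g t ->
  cont_at A (fun s => f s + c * g s) t.
Proof. by move=> fc gc; apply: cvgD => //; apply: cvgMr. Qed.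

Lemma C1_lin f g c : C1_diamond T f -> C1_diamond T g ->
  C1_diamond T (fun s => f s + c * g s).
Proof.
move=> Cf Cg.
apply: (@C1_intro _ (fun t => delta T f t + c * delta T g t)
                    (fun t => nabla T f t + c * nabla T g t)).
- by move=> t kt; apply: is_delta_lin; exact: C1_delta.
- case: Cf Cg => _ + _ _ [_ + _ _] => /within_contP h1 /within_contP h2.
  by apply/within_contP => t kt; apply: cont_at_lin; [exact: h1|exact: h2].
- by move=> t kt; apply: is_nabla_lin; exact: C1_nabla.
- case: Cf Cg => _ _ _ + [_ _ _] => /within_contP h1 /within_contP h2.
  by apply/within_contP => t kt; apply: cont_at_lin; [exact: h1|exact: h2].
Qed.

Lemma ts_compact : compact T.
Proof.
rewrite (_ : T = `[a, b] `&` T).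
  by apply: compact_closedI; [exact: segment_compact|case: TS].
apply/seteqP; split=> [t Tt|t []//]; split=> //=.
by rewrite in_itv /= (ts_lb TS) // (ts_ub TS).
Qed.

Lemma kappa_up_compact : compact (kappa_up T).
Proof.
have [rb|rb] := eqVneq (bjump T b) b.
  rewrite (_ : kappa_up T = T); first exact: ts_compact.
  by rewrite (kappa_upE TS); apply/seteqP; split=> [t []//|t Tt]; split.
rewrite (_ : kappa_up T = T `&` `]-oo, bjump T b]).
  by apply: compact_closedI; [exact: ts_compact|exact: interval_closed].
rewrite (kappa_upE TS); apply/seteqP; split=> t [Tt]; rewrite /= in_itv /=.
  move=> h; split=> //; apply: le_bjump => //.
  apply: (ts_lt_max TS Tt); apply: contra_neq rb => /h; exact.
move=> tr; split=> // tb; move: rb.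
by rewrite eq_le bjump_le /= -{1}tb tr.
Qed.

Lemma compact_fun_bounded (A : set R) f : compact A ->
  {within A, continuous f} -> exists C, forall t, A t -> `|f t| <= C.
Proof.
move=> cA fc; have := compact_bounded (continuous_compact fc cA).
rewrite /bounded_near => h.
have [M /= [_ hM]] := h; exists (M + 1) => t At.
by apply: (hM (M + 1)); [rewrite ltrDl|exists t].
Qed.

(** A point of [T] outside T^kappa is isolated. *)
Lemma C1_cont y : C1_diamond T y -> {within T, continuous y}.
Proof.
move=> Cy; apply/within_contP => t Tt.
have [kt|nkt] := pselect (kappa_up T t).
  by have /is_delta_cont := C1_delta Cy kt.
have [tb rb] : t = b /\ bjump T b != b.
  move: nkt; rewrite (kappa_upE TS) => nkt; split.
    by apply: contrapT => tb; apply: nkt; split.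
  by apply/eqP => rb; apply: nkt; split.
apply/cont_atP => e e0.
have r0 : 0 < b - bjump T b by rewrite subr_gt0 lt_neqAle rb bjump_le.
apply: filterS (near_dist_lt t r0) => s + Ts; rewrite tb.
have [->|/(ts_lt_max TS Ts) sb] := eqVneq s b.
  by move=> _; rewrite subrr normr0 ltW.
by have := le_bjump Ts sb; rewrite ltr0_norm ?subr_lt0 //; lra.
Qed.

End C1.

Lemma is_nabla_eq (R : realType) (T : set R) (a b : R) (f g : R -> R) (t d : R) :
  time_scale T a b -> kappa_dn T (bjump T t) ->
  (forall s, kappa_dn T s -> f s = g s) -> is_nabla T f t d -> is_nabla T g t d.
Proof.
move=> TS kb fg /(is_nabla_refl TS) fd; apply/(is_nabla_refl TS).
have TS' := time_scale_refl TS; have [kt _] := fd.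
apply: is_delta_eq fd => [||s].
- by rewrite fjump_refl (kappa_up_refl TS) /refl /= opprK.
- exact: (near_kappa_up TS').
- by rewrite (kappa_up_refl TS) => /fg.
Qed.

Lemma kappa_dn_compact (R : realType) (T : set R) (a b : R) :
  time_scale T a b -> compact (kappa_dn T).
Proof.
move=> TS; rewrite (_ : kappa_dn T = -%R @` kappa_up (refl T)).
  apply: continuous_compact; last exact: kappa_up_compact (time_scale_refl TS).
  by apply: continuous_subspaceT => x; exact: opp_continuous.
rewrite (kappa_up_refl TS); apply/seteqP; split=> [t kt|_ [t kt <-]] //.
by exists (- t); rewrite ?opprK // /refl /= opprK.
Qed.

(** * Slopes of admissible variations *)

(** The functions whose primitives are in the class C^1: the two conditions
    are continuity of the delta and of the nabla derivative of the
    primitive. *)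
Definition slope (R : realType) (T : set R) (w : R -> R) : Prop :=
  {within T, continuous w} /\ {within T, continuous (w \o bjump T)}.

Section Slopes.
Variables (R : realType) (T : set R) (a b : R).
Hypothesis TS : time_scale T a b.
Implicit Types (f w N : R -> R) (t c e : R).

Lemma slope_cst c : slope T (fun=> c).
Proof. by split; apply/within_contP => t Tt; apply: cvg_cst. Qed.

Lemma slope_lin w1 w2 c : slope T w1 -> slope T w2 ->
  slope T (fun t => w1 t + c * w2 t).
Proof.
move=> [/within_contP h1 /within_contP k1] [/within_contP h2 /within_contP k2].
split; apply/within_contP => t Tt; apply: cont_at_lin.
- exact: h1.
- exact: h2.
- exact: k1.
- exact: k2.
Qed.

Lemma slope_bounded w : slope T w -> exists C, forall t, T t -> `|w t| <= C.
Proof. by move=> [wc _]; exact: compact_fun_bounded (ts_compact TS) wc. Qed.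

Lemma slope_delta w N t : slope T w -> primitive T N w -> kappa_up T t ->
  is_delta T N t (w t).
Proof.
move=> sw; have [C wC] := slope_bounded sw; case: sw => /within_contP wc _ prim kt.
apply: (primitive_delta TS prim (C := C)) => //; first by move=> s Ts _; exact: wC.
by move=> _; apply: wc; exact: kappa_up_sub kt.
Qed.

Lemma slope_nabla w N t : slope T w -> primitive T N w -> kappa_dn T t ->
  is_nabla T N t (w (bjump T t)).
Proof.
move=> sw; have [C wC] := slope_bounded sw; case: sw => /within_contP wc _ prim kt.
apply: (primitive_nabla TS prim (C := C)) => //; first by move=> s Ts _; exact: wC.
by move=> _; apply: wc; exact: kappa_dn_sub kt.
Qed.

Lemma slope_C1 w N : slope T w -> primitive T N w -> C1_diamond T N.
Proof.
move=> sw prim.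
apply: (C1_intro TS (v := w) (n := w \o bjump T)).
- by move=> t; exact: slope_delta.
- case: sw => + _; apply: continuous_subspaceW; exact: kappa_up_sub.
- by move=> t; exact: slope_nabla.
- case: sw => _; apply: continuous_subspaceW; exact: kappa_dn_sub.
Qed.

Lemma sup_norm_le f (B : R) :
  (forall t, kappa_up T t -> kappa_dn T t -> `|f t| <= B) ->
  (sup_norm T f <= B%:E)%E.
Proof.
move=> fB; apply: ge_ereal_sup => _ [t [ku kd] <-].
by rewrite lee_fin; exact: fB.
Qed.

Lemma C1_norm_small f e : C1_diamond T f -> 0 < e ->
  exists2 r, 0 < r & forall c, `|c| < r ->
    (norm1oo T (fun t => c * f t)%R < e%:E)%E.
Proof.
move=> Cf e0; have [_ fdc _ fnc] := Cf.
have [D fD] := compact_fun_bounded (ts_compact TS) (C1_cont TS Cf).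
have [U fU] := compact_fun_bounded (kappa_up_compact TS) fdc.
have [V fV] := compact_fun_bounded (kappa_dn_compact TS) fnc.
pose M := `|D| + `|D| + `|U| + `|V| + 1.
have M0 : 0 < M by rewrite /M ltr_wpDl // !addr_ge0.
exists (e / M); first by rewrite divr_gt0.
move=> c; rewrite ltr_pdivlMr // => cM.
have le_norm x (B : R) : `|x| <= B -> `|c * x| <= `|c| * `|B|.
  by move=> xB; rewrite normrM ler_wpM2l // (le_trans xB) // ler_norm.
have cf : (fun t => c * f t) = (fun t => 0 + c * f t).
  by apply/funext => t; rewrite add0r.
have h1 : (sup_norm T ((fun t => c * f t)%R \o fjump T) <= (`|c| * `|D|)%:E)%E.
  apply: sup_norm_le => t /kappa_up_sub Tt _; apply/le_norm/fD.
  exact: (fjump_in TS).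
have h2 : (sup_norm T ((fun t => c * f t)%R \o bjump T) <= (`|c| * `|D|)%:E)%E.
  apply: sup_norm_le => t /kappa_up_sub Tt _; apply/le_norm/fD.
  exact: (bjump_in TS).
have h3 : (sup_norm T (delta T (fun t => c * f t)%R) <= (`|c| * `|U|)%:E)%E.
  apply: sup_norm_le => t ku _; rewrite cf.
  rewrite (deltaE TS (is_delta_lin c (is_delta_cst 0 ku) (C1_delta Cf ku))).
  by rewrite add0r; apply/le_norm/fU.
have h4 : (sup_norm T (nabla T (fun t => c * f t)%R) <= (`|c| * `|V|)%:E)%E.
  apply: sup_norm_le => t _ kd; rewrite cf.
  have n0 : is_nabla T (fun=> 0) t 0.
    split=> // r r0; near=> s => _.
    by rewrite subrr mul0r subr0 normr0 mulr_ge0 // ltW.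
  rewrite (nablaE TS (is_nabla_lin TS c n0 (C1_nabla Cf kd))).
  by rewrite add0r; apply/le_norm/fV.
rewrite /norm1oo.
apply: le_lt_trans (leeD (leeD (leeD h1 h2) h3) h4) _.
rewrite -!EFinD lte_fin; apply: le_lt_trans cM.
by rewrite /M !mulrDr mulr1 lerDl.
Unshelve. all: by end_near. Qed.

End Slopes.

(** * Step functions among the slopes *)

Section Steps.
Variables (R : realType) (T : set R) (a b : R).
Hypothesis TS : time_scale T a b.
Implicit Types (w : R -> R) (p q r s t x y : R).

(** Precomposed with the backward jump, the indicator of [t <= s] becomes on
    [T] the indicator of [t < s]; both are locally constant at an isolated
    point. *)
Lemma isolated_step_slope t : T t -> bjump T t < t -> t < fjump T t ->
  slope T (fun s => (t <= s)%R%:R).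
Proof.
move=> Tt rt st; split; apply/within_contP => s Ts; apply/cont_atP => e e0.
  have [ts|ts] := leP t s.
    near=> x => Tx; suff -> : t <= x by rewrite subrr normr0 ltW.
    rewrite leNgt; apply/negP => /(le_bjump Tx); rewrite leNgt; apply/negP/negPn.
    by near: x; apply: lt_nbhsr; exact: lt_le_trans ts.
  near=> x => Tx; suff -> : (t <= x) = false by rewrite subrr normr0 ltW.
  by apply/negbTE; rewrite -ltNge; near: x; apply: lt_nbhsl.
have E x : T x -> (t <= bjump T x) = (t < x).
  move=> Tx; apply/idP/idP => [trx|]; last exact: le_bjump.
  have := le_trans trx (bjump_le T x); rewrite le_eqVlt => /predU1P[tx|//].
  by move: trx; rewrite -tx leNgt rt.
rewrite /= E //; have [ts|ts] := ltP t s.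
  near=> x => Tx; rewrite E //; suff -> : t < x by rewrite subrr normr0 ltW.
  by near: x; apply: lt_nbhsr.
near=> x => Tx; rewrite E //.
suff -> : (t < x) = false by rewrite subrr normr0 ltW.
apply/negP => /(fjump_le Tx); rewrite leNgt; apply/negP/negPn.
by near: x; apply: lt_nbhsl; exact: le_lt_trans st.
Unshelve. all: by end_near. Qed.

(** There is room strictly between [p] and [q], and no isolated point; this
    makes the interval infinite, and halving it can go on forever. *)
Definition splittable p q : Prop :=
  [/\ T p, T q, exists s, [/\ T s, p < s & s < q] &
      forall s, T s -> p < s -> s < q -> bjump T s = s \/ fjump T s = s].

Lemma splittable_two p q : splittable p q ->
  exists x y, [/\ T x, T y, p < x, x < y & y < q].
Proof.
move=> [Tp Tq [s [Ts ps sq]] niso].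
have [rs|fs] := niso s Ts ps sq.
  have sp0 : 0 < s - p by rewrite subr_gt0.
  have as_ : a < s by rewrite (le_lt_trans _ ps) // (ts_lb TS).
  have [x [Tx x1 x2]] := left_dense TS as_ rs sp0.
  by exists x, s; split=> //; lra.
have sq0 : 0 < q - s by rewrite subr_gt0.
have sb : s < b by rewrite (lt_le_trans sq) // (ts_ub TS).
have [x [Tx x1 x2]] := right_dense TS sb fs sq0.
by exists s, x; split=> //; lra.
Qed.

Lemma splittable_split p q : splittable p q ->
  exists c, splittable p c /\ splittable c q.
Proof.
move=> spq; have [x [z [Tx Tz px xz zq]]] := splittable_two spq.
case: spq => Tp Tq _ niso.
have spz : splittable p z.
  split=> //; first by exists x.
  by move=> s Ts ps sz; apply: niso => //; exact: lt_trans sz zq.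
have [x' [y [Tx' Ty px' xy yz]]] := splittable_two spz.
exists y; split; split=> //.
- by exists x'.
- by move=> s Ts ps sy; apply: niso => //; lra.
- by exists z.
- by move=> s Ts ys sq; apply: niso => //; lra.
Qed.

Definition midpoint p q : R :=
  xget 0 [set c | splittable p c /\ splittable c q].

(** The point of [T] assigned to the dyadic number [k / 2 ^ n], by successive
    halving of the interval from [p] to [q]. *)
Fixpoint dyadic_point p q (n k : nat) : R :=
  if n is n'.+1 then
    if odd k then midpoint (dyadic_point p q n' k./2) (dyadic_point p q n' k./2.+1)
    else dyadic_point p q n' k./2
  else if k is 0 then p else q.

Section DyadicEmbedding.
Variables (p q : R).
Hypothesis spq : splittable p q.
Let c := dyadic_point p q.

Lemma dyadic_splittable n k : (k < 2 ^ n)%N -> splittable (c n k) (c n k.+1).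
Proof.
elim: n k => [|n IH] k; first by rewrite expn0 ltnS leqn0 => /eqP ->.
rewrite expnS => k2.
have k2n : (k./2 < 2 ^ n)%N.
  rewrite -ltn_double -(mul2n (2 ^ n)); apply: leq_ltn_trans k2.
  by rewrite -{2}(odd_double_half k) leq_addl.
have [s1 s2] := xgetPex 0 (splittable_split (IH _ k2n)).
rewrite /c /= uphalfE; case: (boolP (odd k)) => ok /=.
  by rewrite uphalf_half ok.
by rewrite uphalf_half (negPf ok).
Qed.

Lemma dyadic_point_lt n i j : (i < j)%N -> (j <= 2 ^ n)%N -> c n i < c n j.
Proof.
elim: j => // j IH; rewrite ltnS leq_eqVlt => /predU1P[->|ij] jn.
  have [_ _ [s [_ s1 s2]] _] := dyadic_splittable jn.
  exact: lt_trans s1 s2.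
apply: (lt_trans (IH ij (ltnW jn))).
have [_ _ [s [_ s1 s2]] _] := dyadic_splittable jn.
exact: lt_trans s1 s2.
Qed.

(** The assignment depends only on the dyadic number and not on its
    representation. *)
Lemma dyadic_point_lift n m k : c (n + m) (k * 2 ^ m) = c n k.
Proof.
elim: m => [|m IH]; first by rewrite addn0 muln1.
by rewrite addnS /c /= expnS mulnCA mul2n odd_double doubleK.
Qed.

Lemma dyadic_point_max n : c n (2 ^ n) = q.
Proof. by have := dyadic_point_lift 0 n 1; rewrite add0n mul1n. Qed.

Lemma dyadic_point_min n : c n 0 = p.
Proof. by have := dyadic_point_lift 0 n 0; rewrite add0n mul0n. Qed.

Definition at_dyadic r y : Prop := exists n k,
  [/\ (k <= 2 ^ n)%N, r = k%:R / 2 ^+ n & y = c n k].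

Lemma at_dyadic_lt r1 y1 r2 y2 :
  at_dyadic r1 y1 -> at_dyadic r2 y2 -> r1 < r2 -> y1 < y2.
Proof.
move=> [n [i [iN -> ->]]] [m [j [jN -> ->]]].
rewrite ltr_pdivrMr ?exprn_gt0 // mulrAC ltr_pdivlMr ?exprn_gt0 //.
rewrite -!natrX -!natrM ltr_nat => ij.
rewrite -(dyadic_point_lift n m i) -(dyadic_point_lift m n j) addnC.
by apply: dyadic_point_lt => //; rewrite expnD leq_mul.
Qed.

Lemma at_dyadic_in r y : at_dyadic r y ->
  [/\ T y, p <= y & 0 <= r <= 1].
Proof.
move=> [n [k [kn -> ->]]]; split.
- move: kn; rewrite leq_eqVlt => /predU1P[->|kn].
    by rewrite dyadic_point_max; case: spq.
  by case: (dyadic_splittable kn).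
- rewrite -(dyadic_point_min n); case: k kn => [|k] kn //.
  by apply/ltW/dyadic_point_lt.
- rewrite divr_ge0 ?exprn_ge0 // ler_pdivrMr ?exprn_gt0 //.
  by rewrite mul1r -natrX ler_nat.
Qed.

Lemma at_dyadic_dense u v : 0 <= u -> u < v -> v <= 1 ->
  exists r y, [/\ at_dyadic r y, u < r & r < v].
Proof.
move=> u0 uv v1; have uv0 : 0 < v - u by rewrite subr_gt0.
(* [2 ^ n > n > 1 / (v - u)], so a step of the grid fits between [u] and [v] *)
pose n := (Num.truncn (v - u)^-1).+1.
have n2 : (v - u)^-1 < 2 ^+ n.
  apply: (@lt_trans _ _ n%:R).
    by have /truncn_itv/andP[] : 0 <= (v - u)^-1 by rewrite invr_ge0 ltW.
  by rewrite -natrX ltr_nat ltn_expl.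
have n0 : (0 : R) < 2 ^+ n by rewrite exprn_gt0.
have /truncn_itv/andP[k1 k2] : 0 <= u * 2 ^+ n by rewrite mulr_ge0 // ltW.
set k := (Num.truncn (u * 2 ^+ n)).+1 in k2.
have kv : k%:R / 2 ^+ n < v.
  rewrite ltr_pdivrMr // /k -natr1.
  have : 1 < (v - u) * 2 ^+ n by rewrite -ltr_pdivrMl // mulr1.
  lra.
exists (k%:R / 2 ^+ n), (c n k); split=> //; last by rewrite ltr_pdivlMr.
exists n, k; split=> //.
rewrite -(ler_nat R) natrX -[leRHS]mul1r -ler_pdivrMr // ltW //.
exact: lt_le_trans v1.
Qed.

(** The generalized inverse of the dyadic embedding, an analogue of the Cantor
    function.  The supremum of the empty set is 0, which is the right value
    before [p]. *)
Definition staircase x : R := sup [set r | exists2 y, at_dyadic r y & y <= x].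

Lemma staircase_ub r y x : at_dyadic r y -> y <= x -> r <= staircase x.
Proof.
move=> ry yx; apply: ub_le_sup; last by exists y.
by exists 1 => s [z /at_dyadic_in[_ _ /andP[]]].
Qed.

Lemma staircase_le x u : 0 <= u ->
  (forall r y, at_dyadic r y -> y <= x -> r <= u) -> staircase x <= u.
Proof.
move=> u0 h; rewrite /staircase.
set S := [set r | _]; have [->|/set0P S0] := eqVneq S set0.
  by rewrite sup0.
by apply: ge_sup => // r [y]; exact: h.
Qed.

Lemma staircase_low x : x < p -> staircase x = 0.
Proof.
move=> xp; rewrite /staircase (_ : [set _ | _] = set0) ?sup0 //.
apply/seteqP; split=> // r [y /at_dyadic_in[_ py _] yx].
by move: xp; rewrite ltNge (le_trans py).
Qed.

Lemma staircase_ge0 x : 0 <= staircase x.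
Proof.
have [/staircase_low -> //|px] := ltP x p.
by apply: staircase_ub px; exists 0%N, 0%N; rewrite mul0r.
Qed.

Lemma staircase_le1 x : staircase x <= 1.
Proof. by apply: staircase_le => // r y /at_dyadic_in[_ _ /andP[]]. Qed.

Lemma staircase_high x : q <= x -> staircase x = 1.
Proof.
move=> qx; apply/le_anti; rewrite staircase_le1 /=.
by apply: staircase_ub qx; exists 0%N, 1%N; rewrite divr1.
Qed.

Lemma staircase_gt x u : 0 <= u -> u < staircase x ->
  exists r y, [/\ at_dyadic r y, y < x & u < r].
Proof.
move=> u0 ux.
have [r1 [y1 [ry1 ur rx]]] := at_dyadic_dense u0 ux (staircase_le1 x).
exists r1, y1; split=> //; rewrite ltNge; apply/negP => xy.
suff : staircase x <= r1 by rewrite leNgt rx.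
apply: staircase_le; first by case: (at_dyadic_in ry1) => _ _ /andP[].
move=> r y ry yx; rewrite leNgt; apply/negP => /(at_dyadic_lt ry1 ry).
by rewrite ltNge (le_trans yx).
Qed.

Lemma staircase_lt x v : v <= 1 -> staircase x < v ->
  exists r y, [/\ at_dyadic r y, x < y & r < v].
Proof.
move=> v1 xv.
have [r [y [ry xr rv]]] := at_dyadic_dense (staircase_ge0 x) xv v1.
exists r, y; split=> //; rewrite ltNge; apply/negP => /(staircase_ub ry).
by rewrite leNgt xr.
Qed.

(** Monotone with values that meet every dyadic number: there is no room for a
    jump. *)
Lemma staircase_continuous : continuous staircase.
Proof.
move=> x; apply/cvgrPdist_le => e e0.
have lo : \forall z \near x, staircase x - e <= staircase z.
  have [u0|u0] := ltP (staircase x - e) 0.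
    by near=> z; rewrite (le_trans (ltW u0)) // staircase_ge0.
  have [|r [y [ry yx ur]]] := staircase_gt u0 (x := x); first by rewrite gtrBl.
  near=> z; apply/ltW/(lt_le_trans ur)/(staircase_ub ry)/ltW.
  by near: z; apply: lt_nbhsr.
have hi : \forall z \near x, staircase z <= staircase x + e.
  have [v1|v1] := ltP 1 (staircase x + e).
    by near=> z; rewrite (le_trans _ (ltW v1)) // staircase_le1.
  have [|r [y [ry xy rv]]] := staircase_lt v1 (x := x); first by rewrite ltrDl.
  near=> z; apply: (le_trans _ (ltW rv)); apply: staircase_le.
    by case: (at_dyadic_in ry) => _ _ /andP[].
  move=> r' y' ry' yz; rewrite leNgt; apply/negP => /(at_dyadic_lt ry ry').
  rewrite ltNge (le_trans yz) //; apply/ltW; near: z; exact: lt_nbhsl.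
move: lo hi => /filterS2; apply => z lo hi.
by rewrite distrC ler_distl lo.
Unshelve. all: by end_near. Qed.

(** A gap contains none of the points [dyadic_point], except possibly its
    right end [t].  Were the values at both ends different, some of these
    points at a value strictly in between would lie strictly before [t], hence
    at or before the backward jump, where the staircase would already be
    higher. *)
Lemma staircase_bjump t : T t -> staircase (bjump T t) = staircase t.
Proof.
move=> Tt; apply/le_anti/andP; split.
  apply: staircase_le => [|r y ry yr]; first exact: staircase_ge0.
  by apply: (staircase_ub ry); exact: le_trans (bjump_le T t).
rewrite leNgt; apply/negP => h.
have [r [y [ry yt hr]]] := staircase_gt (staircase_ge0 _) h.
have [Ty _ _] := at_dyadic_in ry.
by have := staircase_ub ry (le_bjump Ty yt); rewrite leNgt hr.
Qed.

Lemma staircase_slope : slope T staircase.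
Proof.
have sc : {within T, continuous staircase}.
  by apply: continuous_subspaceT; exact: staircase_continuous.
split=> //; apply/within_contP => t Tt; move/within_contP/(_ t Tt): sc.
by apply: cont_at_eq => // s Ts /=; rewrite staircase_bjump.
Qed.

End DyadicEmbedding.

Lemma step_between p q : T p -> T q -> (exists s, [/\ T s, p < s & s < q]) ->
  exists w, [/\ slope T w, forall s, T s -> s < p -> w s = 0,
    forall s, T s -> q <= s -> w s = 1 & forall s, T s -> `|w s| <= 1].
Proof.
move=> Tp Tq pq.
have [[t [Tt pt tq rt st]]|niso] := pselect (exists t,
    [/\ T t, p < t, t < q, bjump T t < t & t < fjump T t]).
  exists (fun s => (t <= s)%R%:R); split.
  - exact: isolated_step_slope.
  - by move=> s _ sp; rewrite leNgt (lt_trans sp pt).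
  - by move=> s _ qs; rewrite (le_trans (ltW tq) qs).
  - by move=> s _; case: (t <= s); rewrite ?normr1 ?normr0.
have spq : splittable p q.
  split=> // s Ts ps sq.
  have [->|rs] := eqVneq (bjump T s) s; first by left.
  have [->|fs] := eqVneq (fjump T s) s; first by right.
  exfalso; apply: niso; exists s; split=> //.
    by rewrite lt_neqAle rs bjump_le.
  by rewrite lt_neqAle eq_sym fs fjump_ge.
exists (staircase p q); split.
- exact: staircase_slope.
- by move=> s _; exact: staircase_low.
- by move=> s _; exact: staircase_high.
- by move=> s _; rewrite ger0_norm ?staircase_le1 ?staircase_ge0.
Qed.

(** Slopes converging to the indicator of the points from [t] on.  The transition
    takes place just before [t] if [t] is left-dense, just after [t] if it is
    right-dense, and in no room at all if [t] is isolated. *)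
Lemma step_at t e : T t -> a < t -> t < b -> 0 < e -> exists w p q,
  [/\ slope T w, [/\ T p, T q, p <= t, t <= q & q - p < e],
   forall s, T s -> s < p -> w s = 0,
   forall s, T s -> q <= s -> w s = 1 & forall s, T s -> `|w s| <= 1].
Proof.
move=> Tt at_ tb e0.
have [rt|rt] := eqVneq (bjump T t) t.
  have [p [Tp p1 p2]] := left_dense TS at_ rt e0.
  have tp0 : 0 < t - p by rewrite subr_gt0.
  have [s [Ts s1 s2]] := left_dense TS at_ rt tp0.
  have [|w [h1 h2 h3 h4]] := @step_between p t Tp Tt.
    by exists s; split=> //; lra.
  by exists w, p, t; split=> //; split=> //; lra.
have [st|st] := eqVneq (fjump T t) t.
  have [q [Tq q1 q2]] := right_dense TS tb st e0.
  have tq0 : 0 < q - t by rewrite subr_gt0.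
  have [s [Ts s1 s2]] := right_dense TS tb st tq0.
  have [|w [h1 h2 h3 h4]] := @step_between t q Tt Tq.
    by exists s; split=> //; lra.
  by exists w, t, q; split=> //; split=> //; lra.
exists (fun s => (t <= s)%R%:R), t, t; split.
- apply: isolated_step_slope => //; first by rewrite lt_neqAle rt bjump_le.
  by rewrite lt_neqAle eq_sym st fjump_ge.
- by rewrite subrr; split.
- by move=> s _ st'; rewrite leNgt st'.
- by move=> s _ ->.
- by move=> s _; case: (t <= s); rewrite ?normr1 ?normr0.
Qed.

End Steps.

(** * Rd-continuous functions *)

Definition uncurry3 (R : realType) (f : R -> R -> R -> R) : R * R * R -> R :=
  fun p => f p.1.1 p.1.2 p.2.

(** Usual rd-continuity also asks for left limits at left-dense points; only
    boundedness is required here in their place.  Compositions with the forward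
    jump are in this class although they are in general not continuous at
    left-dense right-scattered points. *)
Definition rd_cont (R : realType) (T : set R) (g : R -> R) : Prop :=
  (exists C, forall t, kappa_up T t -> `|g t| <= C) /\
  forall t, kappa_up T t -> fjump T t = t -> cont_at T g t.

Lemma cvg_pair_at (I : Type) (U V : topologicalType) (F : set_system I)
  (f : I -> U) (g : I -> V) (x : U) (y : V) : Filter F ->
  f @ F --> x -> g @ F --> y -> (fun s => (f s, g s)) @ F --> (x, y).
Proof. by move=> FF fx gy; apply: (@cvg_pair _ _ _ F (nbhs x) (nbhs y)). Qed.

Section RdContinuity.
Variables (R : realType) (T : set R) (a b : R).
Hypothesis TS : time_scale T a b.
Implicit Types (f g w y : R -> R) (t d : R).

Lemma is_delta_eqT f g t d :
  (forall s, T s -> f s = g s) -> is_delta T f t d -> is_delta T g t d.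
Proof.
move=> fg [kt h]; split=> // e e0; apply: filterS (h e e0) => s {}h Ts.
by rewrite -!fg ?h //; exact: (fjump_in TS) (kappa_up_sub kt).
Qed.

(** At a right-scattered point the primitive has the right slope whatever the
    integrand does nearby. *)
Lemma rd_antiderivative g : rd_cont T g ->
  exists N, forall t, kappa_up T t -> is_delta T N t (g t).
Proof.
move=> [[C gC] gc].
have gC' t : T t -> t < b -> `|g t| <= C.
  by move=> Tt tb; apply: gC; exact: (kappa_up_lt TS).
have [N prim] := primitive_exists TS gC'.
by exists N => t kt; apply: (primitive_delta TS prim gC') => //; exact: gc.
Qed.

Lemma rd_within_kappa g : {within kappa_up T, continuous g} -> rd_cont T g.
Proof.
move=> gc; split; first exact: compact_fun_bounded (kappa_up_compact TS) gc.
move=> t kt _; move/within_contP/(_ t kt): gc; apply: cont_at_near.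
exact: (near_kappa_up TS).
Qed.

Lemma rd_within g : {within T, continuous g} -> rd_cont T g.
Proof.
by move=> gc; apply: rd_within_kappa; apply: continuous_subspaceW gc; exact: kappa_up_sub.
Qed.

Lemma rd_delta g g' : (forall t, kappa_up T t -> is_delta T g t (g' t)) ->
  rd_cont T g.
Proof.
move=> gd; apply: rd_within_kappa; apply/within_contP => t kt.
apply: cont_at_near (is_delta_cont (gd t kt)); near=> s; exact: kappa_up_sub.
Unshelve. all: by end_near. Qed.

Lemma fjump_cont t : T t -> fjump T t = t -> cont_at T (fjump T) t.
Proof.
move=> Tt st; apply/cont_atP => e e0; rewrite st.
have [x tx xe] : exists2 x, t < x &
    forall s, T s -> s < x -> fjump T s <= t + e.
  have [->|/(ts_lt_max TS Tt) tb] := eqVneq t b.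
    exists (b + 1); first by rewrite ltrDl.
    move=> s Ts _; have := ts_ub TS (fjump_in TS Ts); lra.
  have [x [Tx x1 x2]] := right_dense TS tb st e0.
  by exists x => // s Ts sx; rewrite (le_trans (fjump_le Tx sx)) // ltW.
near=> s => Ts; rewrite distrC ler_distl xe ?andbT //.
  have : t - e < s by near: s; apply: lt_nbhsr; lra.
  have := fjump_ge T s; lra.
by near: s; apply: lt_nbhsl.
Unshelve. all: by end_near. Qed.

Lemma rd_fjump y : {within T, continuous y} -> rd_cont T (y \o fjump T).
Proof.
move=> yc; have [C yC] := compact_fun_bounded (ts_compact TS) yc.
split; first by exists C => t kt; apply: yC; exact: (fjump_in TS) (kappa_up_sub kt).
move=> t kt st; have Tt := kappa_up_sub kt.
move/within_contP/(_ t Tt)/cont_atP: yc => yc.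
apply/cont_atP => e e0; have [r r0 {}yc] := near_distP (yc e e0).
have r2 : 0 < r / 2 by rewrite divr_gt0.
have /cont_atP/(_ _ r2) := fjump_cont Tt st; apply: filterS => s h Ts.
rewrite /= st; apply: yc; last exact: (fjump_in TS).
have := h Ts; rewrite st distrC => h1; apply: le_lt_trans h1 _; lra.
Qed.

Let box (C : R) : set (R * R * R) := (`[- C, C] `*` `[- C, C]) `*` `[- C, C].

Let box_compact C : compact (box C).
Proof.
by apply: compact_setX; [apply: compact_setX|]; exact: segment_compact.
Qed.

Let boxP C (t x v : R) :
  `|t| <= C -> `|x| <= C -> `|v| <= C -> box C (t, x, v).
Proof. by move=> tC xC vC; split=> /=; first split; rewrite /= in_itv /= -ler_norml. Qed.

Lemma rd_comp (f : R -> R -> R -> R) g1 g2 : continuous (uncurry3 f) ->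
  rd_cont T g1 -> rd_cont T g2 -> rd_cont T (fun t => f t (g1 t) (g2 t)).
Proof.
move=> fc [[C1 h1] c1] [[C2 h2] c2]; split; last first.
  move=> t kt st.
  apply: (@cvg_comp _ _ _ (fun s => (s, g1 s, g2 s)) (uncurry3 f) _
          (nbhs (t, g1 t, g2 t))); last exact: (fc (t, g1 t, g2 t)).
  apply: cvg_pair_at; last exact: c2.
  by apply: cvg_pair_at; [exact: cvg_within|exact: c1].
pose C := `|a| + `|b| + `|C1| + `|C2|.
have bC : bounded_set (uncurry3 f @` box C).
  apply: compact_bounded; apply: continuous_compact => //.
  exact: continuous_subspaceT.
have [M /= [_ hM]] := bC; exists (M + 1) => t kt.
apply: (hM (M + 1)); first by rewrite ltrDl.
exists (t, g1 t, g2 t) => //; apply: boxP.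
- have Tt := kappa_up_sub kt; have := ts_lb TS Tt; have := ts_ub TS Tt.
  move=> tb ta; rewrite /C ler_norml.
  have := normr_ge0 C1; have := normr_ge0 C2.
  have := ler_norm b; have := ler_norm (- a); rewrite normrN.
  have := normr_ge0 a; have := normr_ge0 b; lra.
- apply: (le_trans (h1 t kt)); rewrite /C.
  have := normr_ge0 a; have := normr_ge0 b; have := normr_ge0 C2.
  have := ler_norm C1; lra.
- apply: (le_trans (h2 t kt)); rewrite /C.
  have := normr_ge0 a; have := normr_ge0 b; have := normr_ge0 C1.
  have := ler_norm C2; lra.
Qed.

Lemma rd_lin g1 g2 c : rd_cont T g1 -> rd_cont T g2 ->
  rd_cont T (fun t => g1 t + c * g2 t).
Proof.
apply: (@rd_comp (fun _ x v => x + c * v)) => p.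
apply: cvgD; first by apply: cvg_comp; [exact: cvg_fst|exact: cvg_snd].
by apply: cvgMr; exact: cvg_snd.
Qed.

Lemma rd_mul g1 g2 : rd_cont T g1 -> rd_cont T g2 ->
  rd_cont T (fun t => g1 t * g2 t).
Proof.
apply: (@rd_comp (fun _ x v => x * v)) => p.
apply: cvgM; last exact: cvg_snd.
by apply: cvg_comp; [exact: cvg_fst|exact: cvg_snd].
Qed.

(** By compactness of the cube; only the base point has to lie in it. *)
Lemma box_unif_continuous (f : R -> R -> R -> R) C e :
  continuous (uncurry3 f) -> 0 < e ->
  exists2 r, 0 < r & forall t x v x' v', `|t| <= C -> `|x| <= C -> `|v| <= C ->
    `|x' - x| <= r -> `|v' - v| <= r -> `|f t x' v' - f t x v| <= e.
Proof.
move=> fc e0.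
pose P (r : R) (p : R * R * R) := forall x' v', `|x' - p.1.2| <= r ->
  `|v' - p.2| <= r -> `|f p.1.1 x' v' - uncurry3 f p| <= e.
have e2 : 0 < e / 2 by rewrite divr_gt0.
have : \forall r \near 0^'+, box C `<=` P r.
  apply: (proj1 (compact_near_coveringP (box C)) (@box_compact C)).
  move=> p0 _; have /cvgrPdist_le/(_ _ e2)/nbhs_ballP[d /= d0 h] := fc p0.
  have d2 : 0 < d / 2 by rewrite divr_gt0.
  exists (ball p0 (d / 2), [set r | r < d / 2]) => /=.
    split; first exact: nbhsx_ballx.
    by apply: nbhs_right_lt.
  move=> [p r] /= [pb rd] x' v' xr vr.
  have pb' : ball p0 d p by apply: le_ball pb; lra.
  have pb'' : ball p0 d (p.1.1, x', v').
    case: pb => [[p1 p2] p3]; rewrite /ball /= in p1 p2 p3.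
    split; first split; rewrite /ball /=.
    - by apply: lt_trans p1 _; lra.
    - rewrite -[p0.1.2 - x'](subrKA p.1.2); apply: le_lt_trans (ler_normD _ _) _.
      by rewrite [d]splitr ltrD // distrC (le_lt_trans xr).
    - rewrite -[p0.2 - v'](subrKA p.2); apply: le_lt_trans (ler_normD _ _) _.
      by rewrite [d]splitr ltrD // distrC (le_lt_trans vr).
  have := h _ pb'; have := h _ pb''; rewrite /uncurry3 /= => h1 h2.
  rewrite -(subrKA (f p0.1.1 p0.1.2 p0.2)) [e]splitr.
  by apply: le_trans (ler_normD _ _) _; rewrite lerD // distrC.
move=> /(@filterI _ _ _ _ _ (nbhs_right_gt 0)) /filter_ex[r [r0 h]].
exists r => // t x v x' v' tC xC vC; exact: (h (t, x, v) (boxP tC xC vC)).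
Qed.

Lemma mean_value_norm (f df : R -> R) (x h d e : R) :
  (forall z : R, is_derive z 1 f (df z)) ->
  (forall z, `|z - x| <= `|h| -> `|df z - d| <= e) ->
  `|f (x + h) - f x - d * h| <= e * `|h|.
Proof.
move=> fd dfe.
have fc z : {for z, continuous f}.
  by apply/differentiable_continuous/derivable1_diffP; case: (fd z).
have fcw (u v : R) : {within `[u, v], continuous f} by exact: continuous_subspaceT.
have key : exists2 c, `|c - x| <= `|h| & f (x + h) - f x = df c * h.
  have [h0|/ltW h0] := leP 0 h.
    have xh : x <= x + h by rewrite lerDl.
    have [c] := MVT_segment xh (fun z _ => fd z) (fcw _ _).
    rewrite in_itv /= => /andP[c1 c2] E.
    exists c; last by rewrite E; congr (_ * _); ring.
    by rewrite !ger0_norm ?subr_ge0 //; lra.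
  have xh : x + h <= x by rewrite gerDl.
  have [c] := MVT_segment xh (fun z _ => fd z) (fcw _ _).
  rewrite in_itv /= => /andP[c1 c2] E.
  exists c; last by rewrite -opprB E -mulrN; congr (_ * _); ring.
  by rewrite !ler0_norm ?subr_le0 //; lra.
have [c ch ->] := key.
by rewrite -mulrBl normrM ler_wpM2r // dfe.
Qed.

End RdContinuity.

(** * First variation and the lemma of du Bois-Reymond *)

Definition lagrangian_C1 (R : realType) (M : R -> R -> R -> R) : Prop :=
  [/\ continuous (uncurry3 M), continuous (uncurry3 (partial2 M)),
      continuous (uncurry3 (partial3 M)),
      forall t x v, derivable (fun s => M t s v) x 1
    & forall t x v, derivable (fun s => M t x s) v 1].

Lemma smooth_lagrangian_C1 (R : realType) (M : R -> R -> R -> R) :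
  Ck 1 M -> lagrangian_C1 M.
Proof.
move=> [c [d [_ [c2 _] [c3 _]]]]; split=> //.
- by move=> t x v; case: (d t x v).
- by move=> t x v; case: (d t x v).
Qed.

Section Variation.
Variables (R : realType) (T : set R) (a b : R).
Hypothesis TS : time_scale T a b.
Implicit Types (f g w : R -> R) (t x v h k e C : R).

Lemma lagrangian_expansion M C e : lagrangian_C1 M -> 0 < e ->
  exists2 r, 0 < r & forall t x v h k,
    `|t| <= C -> `|x| <= C -> `|v| <= C -> `|h| <= r -> `|k| <= r ->
    `|M t (x + h) (v + k) - M t x v
      - (partial2 M t x v * h + partial3 M t x v * k)| <= e * (`|h| + `|k|).
Proof.
move=> [_ c2 c3 d2 d3] e0.
have [r2 r20 h2] := box_unif_continuous C c2 e0.
have [r3 r30 h3] := box_unif_continuous C c3 e0.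
exists (Num.min r2 r3); first by rewrite lt_min r20.
move=> t x v h k tC xC vC; rewrite !le_min => /andP[hr2 hr3] /andP[kr2 kr3].
rewrite (_ : _ - _ =
  (M t (x + h) (v + k) - M t x (v + k) - partial2 M t x v * h) +
  (M t x (v + k) - M t x v - partial3 M t x v * k)); last by ring.
apply: le_trans (ler_normD _ _) _; rewrite mulrDr lerD //.
  apply: (@mean_value_norm _ (fun s => M t s (v + k))
                             (fun s => partial2 M t s (v + k))).
    by move=> z; rewrite /partial2 derive1E; apply: derivableP.
  move=> z zx; apply: h2 => //; first exact: le_trans hr2.
  by rewrite addrAC subrr add0r.
apply: (@mean_value_norm _ (fun s => M t x s) (fun s => partial3 M t x s)).
  by move=> z; rewrite /partial3 derive1E; apply: derivableP.
move=> z zv; apply: h3 => //; last exact: le_trans kr3.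
by rewrite subrr normr0 ltW.
Qed.

(** The increment of the functional is [c * (B b - B a)] up to an error
    [|c| e'] with [e'] arbitrarily small, by integrating
    [lagrangian_expansion]; nonnegativity for both signs of [c] leaves no
    choice.  Only the mean value inequality is used to integrate the error. *)
Lemma first_variation M X V hX hV B : lagrangian_C1 M ->
  rd_cont T X -> rd_cont T V -> rd_cont T hX -> rd_cont T hV ->
  (exists2 r, 0 < r & forall c, `|c| < r ->
     delta_int T a b (fun t => M t (X t) (V t)) <=
     delta_int T a b (fun t => M t (X t + c * hX t) (V t + c * hV t))) ->
  (forall t, kappa_up T t -> is_delta T B t
     (partial2 M t (X t) (V t) * hX t + partial3 M t (X t) (V t) * hV t)) ->
  B b = B a.
Proof.
move=> CM rX rV rhX rhV [r0 r00 min] Bd.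
have cM : continuous (uncurry3 M) by case: CM.
pose A0' t := M t (X t) (V t).
have [A0 A0d] := rd_antiderivative TS (rd_comp TS cM rX rV).
have [CX XC] := proj1 rX; have [CV VC] := proj1 rV.
have [CH HXC] := proj1 rhX; have [CK HVC] := proj1 rhV.
pose C := `|a| + `|b| + `|CX| + `|CV|.
pose H := `|CH| + `|CK| + 1.
have H0 : 0 < H by rewrite ltr_wpDl // addr_ge0.
have ba0 : 0 < b - a by rewrite subr_gt0 (ts_lt TS).
have Ta := ts_min TS; have Tb := ts_max TS.
apply/eqP; rewrite -subr_eq0 -normr_le0; apply/ler_addgt0Pr => e' e'0.
rewrite add0r; pose e := e' / (H * (b - a)).
have e0 : 0 < e by rewrite divr_gt0 // mulr_gt0.
have [r rr0 exp] := lagrangian_expansion C CM e0.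
(* the increment of the functional, with the error of the expansion *)
have key c : 0 < `|c| -> `|c| < r0 -> `|c| * H <= r ->
    0 <= c * (B b - B a) + `|c| * e'.
  move=> c0 cr0 cr; have := min c cr0.
  have [A Ad] := rd_antiderivative TS
    (rd_comp TS cM (rd_lin TS c rX rhX) (rd_lin TS c rV rhV)).
  rewrite (delta_intE TS A0d) (delta_intE TS Ad) => le.
  pose D t := (A t + (-1) * A0 t) + (- c) * B t.
  pose D' t := (M t (X t + c * hX t) (V t + c * hV t) + (-1) * M t (X t) (V t))
    + (- c) * (partial2 M t (X t) (V t) * hX t + partial3 M t (X t) (V t) * hV t).
  have Dd t : kappa_up T t -> is_delta T D t (D' t).
    move=> kt; apply: is_delta_lin (Bd t kt).
    by apply: is_delta_lin (A0d t kt); exact: Ad.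
  have D'b t : T t -> a <= t -> t < b -> `|D' t| <= e * (`|c| * H).
    move=> Tt at_ tb; have kt := kappa_up_lt TS Tt tb.
    have hXb : `|hX t| <= `|CH| := le_trans (HXC t kt) (ler_norm _).
    have hVb : `|hV t| <= `|CK| := le_trans (HVC t kt) (ler_norm _).
    have chX : `|c * hX t| <= `|c| * `|CH| by rewrite normrM ler_wpM2l.
    have chV : `|c * hV t| <= `|c| * `|CK| by rewrite normrM ler_wpM2l.
    have cHK : `|c| * `|CH| + `|c| * `|CK| + `|c| = `|c| * H by rewrite /H; ring.
    have c1 : 0 <= `|c| * `|CH| by rewrite mulr_ge0.
    have c2 : 0 <= `|c| * `|CK| by rewrite mulr_ge0.
    have -> : D' t = M t (X t + c * hX t) (V t + c * hV t) - M t (X t) (V t) -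
       (partial2 M t (X t) (V t) * (c * hX t) + partial3 M t (X t) (V t) * (c * hV t)).
      by rewrite /D'; ring.
    have n1 := normr_ge0 a; have n2 := normr_ge0 b.
    have n3 := normr_ge0 CX; have n4 := normr_ge0 CV.
    apply: le_trans (exp t (X t) (V t) _ _ _ _ _ _ _) _.
    - have := ler_norm b; have := ler_norm (- a); rewrite normrN ler_norml /C; lra.
    - by apply: le_trans (XC t kt) (le_trans (ler_norm _) _); rewrite /C; lra.
    - by apply: le_trans (VC t kt) (le_trans (ler_norm _) _); rewrite /C; lra.
    - lra.
    - lra.
    - by rewrite ler_pM2l //; lra.
  have := delta_mean_value TS Dd Ta Tb (ltW (ts_lt TS)) D'b.
  have -> : e * (`|c| * H) * (b - a) = `|c| * e'.
    by rewrite /e; field; rewrite !gt_eqF.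
  rewrite ler_norml /D => /andP[_]; lra.
pose c := Num.min (r0 / 2) (r / H).
have c0 : 0 < c by rewrite lt_min !divr_gt0.
have cr0 : c < r0 by rewrite gt_min; apply/orP; left; lra.
have cr : c * H <= r by rewrite -ler_pdivlMr // ge_min lexx orbT.
have := key c; have := key (- c); rewrite normrN (gtr0_norm c0).
move=> /(_ c0 cr0 cr) k1 /(_ c0 cr0 cr) k2.
rewrite -(ler_pM2l c0) -[X in X * `|_|](gtr0_norm c0) -normrM ler_norml; lra.
Qed.

(** Let [N] be a primitive of [K].  Testing with the slopes of [step_at], which
    approximate the indicator of the points from [t] on, gives
    [N b - N t = 0].  So [N] is constant on [T], and its derivative [K] is zero
    at every point of T^kappa, not only almost everywhere. *)
Lemma du_bois_reymond K : rd_cont T K ->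
  (forall w Q, slope T w ->
    (forall t, kappa_up T t -> is_delta T Q t (K t * w t)) -> Q b = Q a) ->
  forall t, kappa_up T t -> K t = 0.
Proof.
move=> rK orth.
have [N Nd] := rd_antiderivative TS rK.
have Nba : N b = N a.
  by apply: orth (slope_cst T 1) _ => t kt; rewrite mulr1; exact: Nd.
have [C KC] := proj1 rK.
have C0 : 0 <= C.
  by apply: le_trans (normr_ge0 _) (KC a _); exact: (kappa_up_lt TS (ts_min TS) (ts_lt TS)).
suff Nb t : T t -> N t = N b.
  move=> t kt; apply: (is_delta_uniq TS (Nd t kt)).
  by apply: (is_delta_eqT TS _ (is_delta_cst (N b) kt)) => s /Nb ->.
move=> Tt; have [->//|/(ts_lt_max TS Tt) tb] := eqVneq t b.
have [->//|/(ts_gt_min TS Tt) ta] := eqVneq t a.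
apply/eqP; rewrite eq_sym -subr_eq0 -normr_le0; apply/ler_addgt0Pr => e' e'0.
rewrite add0r; pose e := e' / (2 * (C + 1)).
have C1 : 0 < 2 * (C + 1) by rewrite mulr_gt0 // ltr_wpDl.
have e0 : 0 < e by rewrite divr_gt0.
have [w [p [q [sw [Tp Tq pt tq pqe] w0 w1 wb]]]] := step_at TS Tt ta tb e0.
have rw : rd_cont T w by apply: (rd_within TS); case: sw.
have [Q Qd] := rd_antiderivative TS (rd_mul TS rK rw).
have Qba := orth w Q sw Qd.
have Ta := ts_min TS; have Tb := ts_max TS.
have KCb s : T s -> s < b -> `|K s| <= C by move=> Ts sb; apply/KC/(kappa_up_lt TS).
have qb := ts_ub TS Tq; have ap := ts_lb TS Tp.
have Qpa : Q p = Q a.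
  apply/eqP; rewrite -subr_eq0 -normr_le0 -[leRHS](mul0r (p - a)).
  apply: (delta_mean_value TS Qd) => // s Ts _ sp.
  by rewrite w0 // mulr0 normr0.
have Qqp : `|Q q - Q p| <= C * (q - p).
  apply: (delta_mean_value TS Qd) => //; first exact: le_trans tq.
  move=> s Ts ps sq; rewrite normrM -[C]mulr1 ler_pM //; last exact: wb.
  by apply: KCb => //; exact: lt_le_trans qb.
have Nqt : `|N q - N t| <= C * (q - t).
  apply: (delta_mean_value TS Nd) => // s Ts ts sq.
  by apply: KCb => //; exact: lt_le_trans qb.
have QNd s : kappa_up T s ->
    is_delta T (fun x => Q x + (-1) * N x) s (K s * w s + (-1) * K s).
  by move=> ks; apply: is_delta_lin; [exact: Qd|exact: Nd].
(* after [q] the slope is 1, so [Q] and [N] grow alike *)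
have QN : (Q b + (-1) * N b) - (Q q + (-1) * N q) = 0.
  apply/eqP; rewrite -normr_le0 -[leRHS](mul0r (b - q)).
  apply: (delta_mean_value TS QNd) => // s Ts qs sb.
  by rewrite w1 // mulr1 mulN1r subrr normr0.
have -> : N b - N t = (N q - N t) - (Q q - Q p) by lra.
apply: le_trans (ler_normB _ _) _.
have h1 : C * (q - p) <= C * e by rewrite ler_wpM2l // ltW.
have h2 : C * (q - t) <= C * e by rewrite ler_wpM2l //; lra.
have h3 : e' = 2 * (C * e) + 2 * e by rewrite /e; field; rewrite gt_eqF //; lra.
lra.
Qed.

(** The constant [c0] is the mean of [F - G0].  For a slope [w] of mean [m],
    the slope [w - m] has a primitive that vanishes at both ends, so it is an
    admissible variation; since [K = F - G0 - c0] has mean zero, the integral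
    of [K w] is that of [(F - G0) (w - m)], which the first variation and the
    product rule show to be zero. *)
Lemma euler_lagrange_integral M X V : lagrangian_C1 M ->
  rd_cont T X -> rd_cont T V ->
  (forall w eta, slope T w -> primitive T eta w -> eta a = 0 -> eta b = 0 ->
     exists2 r, 0 < r & forall c, `|c| < r ->
     delta_int T a b (fun t => M t (X t) (V t)) <=
     delta_int T a b (fun t => M t (X t + c * eta (fjump T t)) (V t + c * w t))) ->
  exists G, forall t, kappa_up T t ->
    is_delta T G t (partial2 M t (X t) (V t)) /\ partial3 M t (X t) (V t) = G t.
Proof.
move=> CM rX rV min; have [_ c2 c3 _ _] := CM.
have Ta := ts_min TS; have Tb := ts_max TS.
have ba0 : 0 < b - a by rewrite subr_gt0 (ts_lt TS).
have [G0 G0d] := rd_antiderivative TS (rd_comp TS c2 rX rV).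
pose F t := partial3 M t (X t) (V t).
have rK0 : rd_cont T (fun t => F t + (-1) * G0 t).
  by apply: (rd_lin TS); [exact: (rd_comp TS c3)|exact: (rd_delta TS G0d)].
have [N0 N0d] := rd_antiderivative TS rK0.
pose c0 := (N0 b - N0 a) / (b - a).
pose K t := (F t + (-1) * G0 t) + (- c0) * 1.
have rcst (c : R) : rd_cont T (fun=> c).
  by apply: (rd_within TS); case: (slope_cst T c).
have rK : rd_cont T K by apply: (rd_lin TS).
have Nd t : kappa_up T t -> is_delta T (fun t => N0 t + (- c0) * id t) t (K t).
  by move=> kt; apply: is_delta_lin; [exact: N0d|exact: is_delta_id].
have Kz : forall t, kappa_up T t -> K t = 0.
  apply: (du_bois_reymond rK) => w Q sw Qd.
  have [C wC] := slope_bounded TS sw.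
  have [W Wp] := primitive_exists TS (fun t Tt _ => wC t Tt).
  pose m := (W b - W a) / (b - a).
  pose w' t := w t + (- m) * 1.
  pose eta t := W t - W a - m * (t - a).
  have sw' : slope T w' by apply: slope_lin => //; exact: slope_cst.
  have etap : primitive T eta w'.
    move=> p q d e Tp Tq pq h.
    have -> : eta q - eta p - d * (q - p) = W q - W p - (d + m) * (q - p).
      by rewrite /eta; ring.
    apply: Wp => // t Tt pt tq; have := h t Tt pt tq.
    by rewrite /w' (_ : w t + _ - d = w t - (d + m)) //; ring.
  have etaa : eta a = 0 by rewrite /eta !subrr mulr0 subrr.
  have etab : eta b = 0 by rewrite /eta /m divfK ?subrr // gt_eqF.
  have etad t : kappa_up T t -> is_delta T eta t (w' t).
    exact: (slope_delta TS sw' etap).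
  (* [P] is an antiderivative of [(F - G0) w'], [B] of the first variation *)
  pose P t := (Q t + (- m) * (N0 t + (- c0) * id t)) + c0 * eta t.
  pose B t := G0 t * eta t + 1 * P t.
  have Bd t : kappa_up T t -> is_delta T B t
     (partial2 M t (X t) (V t) * eta (fjump T t) + partial3 M t (X t) (V t) * w' t).
    move=> kt.
    have Pd : is_delta T P t (K t * w t + (- m) * K t + c0 * w' t).
      apply: is_delta_lin; last exact: etad.
      by apply: is_delta_lin; [exact: Qd|exact: Nd].
    have := is_delta_lin 1 (is_delta_mul (G0d t kt) (etad t kt)) Pd.
    by congr is_delta; rewrite /K /w' /F; ring.
  have reta : rd_cont T (eta \o fjump T).
    by apply/(rd_fjump TS)/(C1_cont TS)/(slope_C1 TS sw' etap).
  have rw' : rd_cont T w' by apply: (rd_within TS); case: sw'.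
  have := first_variation CM rX rV reta rw' (min w' eta sw' etap etaa etab) Bd.
  rewrite /B /P etaa etab.
  have -> : N0 b + - c0 * id b = N0 a + - c0 * id a.
    have : c0 * (b - a) = N0 b - N0 a by rewrite /c0 divfK // gt_eqF.
    rewrite /=; lra.
  lra.
exists (fun t => G0 t + c0 * 1) => t kt; split.
  have := is_delta_lin c0 (G0d t kt) (is_delta_cst 1 kt).
  by rewrite mulr0 addr0.
have := Kz t kt; rewrite /K /F; lra.
Qed.

End Variation.

(** * Derivatives of the piecewise linear extension *)

Section Interpolation.
Variables (R : realType) (T : set R) (a b : R).
Hypothesis TS : time_scale T a b.
Implicit Types (f g : R -> R) (t d u : R).

Lemma gap_bounds tau : ~ T tau -> a < tau -> tau < b ->
  [/\ T (bjump T tau), T (fjump T (bjump T tau)),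
      bjump T tau < tau & tau < fjump T (bjump T tau)].
Proof.
move=> nT at_ tb; set s := bjump T tau.
have Ts : T s := bjump_in_gt TS at_.
have st : s < tau.
  by rewrite lt_neqAle bjump_le andbT; apply/eqP => h; apply: nT; rewrite -h.
have sb := lt_trans st tb.
have above x : T x -> s < x -> tau < x.
  move=> Tx sx; rewrite ltNge; apply/negP; rewrite le_eqVlt => /predU1P[xt|xt].
    by apply: nT; rewrite -xt.
  by have := le_bjump Tx xt; rewrite leNgt sx.
have Tq : T (fjump T s) := fjump_in_lt TS sb.
split=> //; apply: (above) => //.
rewrite lt_neqAle fjump_ge andbT; apply/eqP => /esym sE.
have ts0 : 0 < tau - s by rewrite subr_gt0.
have [x [Tx sx xt]] := right_dense TS sb sE ts0.
by have := above x Tx sx; lra.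
Qed.

(** In a gap, the error of the linear approximation is a convex combination of
    the errors at the two ends, and so is the bound [e * (tau - t)]; no
    constant is lost by passing from [T] to the interval. *)
Lemma bar_right_estimate f t d e : is_delta T f t d -> 0 < e -> t < b ->
  exists2 x, t < x & forall tau, t < tau -> tau < x ->
    `|bar T f tau - bar T f t - d * (tau - t)| <= e * (tau - t).
Proof.
move=> fd e0 tb; have Tt := kappa_up_sub (proj1 fd).
have [x [Tx tx xb hx]] := is_delta_right TS fd e0 (ts_max TS) tb.
exists x => // tau ttau taux; rewrite {2}/bar; case: asboolP => // _.
rewrite /bar; case: asboolP => [Ttau|nT].
  by apply: hx => //; exact: ltW.
have at_ : a < tau by rewrite (le_lt_trans _ ttau) // (ts_lb TS).
have [Ts Tq] := gap_bounds nT at_ (lt_le_trans taux xb).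
have ts : t <= bjump T tau by rewrite le_bjump.
have qx : fjump T (bjump T tau) <= x.
  by rewrite fjump_le // (le_lt_trans _ taux) // bjump_le.
move: ts qx Ts Tq; set s := bjump T tau; set q := fjump T s.
move=> ts qx Ts Tq st tq; have sq := lt_trans st tq.
have h1 := hx s Ts ts (le_trans (ltW sq) qx).
have h2 := hx q Tq (le_trans ts (ltW sq)) qx.
have sq0 : 0 < q - s by rewrite subr_gt0.
set th := (tau - s) / (q - s).
have th0 : 0 <= th by rewrite divr_ge0 // ?subr_ge0 ltW.
have th1 : 0 <= 1 - th by rewrite subr_ge0 ler_pdivrMr // mul1r lerD2r ltW.
have tauE : tau = s + th * (q - s) by rewrite /th divfK ?gt_eqF //; ring.
have -> : f s + (f q - f s) / (q - s) * (tau - s) - f t - d * (tau - t) =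
   (1 - th) * (f s - f t - d * (s - t)) + th * (f q - f t - d * (q - t)).
  by rewrite [X in d * (X - t)]tauE /th; field; rewrite gt_eqF.
have -> : e * (tau - t) = (1 - th) * (e * (s - t)) + th * (e * (q - t)).
  by rewrite tauE; ring.
apply: le_trans (ler_normD _ _) _.
rewrite (normrM (1 - th)) (normrM th) (ger0_norm th0) (ger0_norm th1).
by rewrite lerD // ler_wpM2l.
Qed.

Lemma bar_refl f tau : a <= tau -> tau <= b ->
  bar (refl T) (f \o -%R) (- tau) = bar T f tau.
Proof.
move=> at_ tb; rewrite /bar {1}/refl /= opprK; case: asboolP => // nT.
have neqT x : T x -> tau != x by move=> Tx; apply/eqP => xE; apply: nT; rewrite xE.
have at' : a < tau by rewrite lt_neqAle at_ eq_sym neqT //; exact: ts_min TS.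
have tb' : tau < b by rewrite lt_neqAle tb neqT //; exact: ts_max TS.
have [Ts Tq st tq] := gap_bounds nT at' tb'.
have sq := lt_trans st tq.
have qE : fjump T tau = fjump T (bjump T tau).
  apply/le_anti; rewrite fjump_le //=; apply: fjump_le; first exact: fjump_in_lt TS _ tb'.
  exact: lt_le_trans (fjump_ge _ _).
have sE : bjump T (fjump T (bjump T tau)) = bjump T tau.
  apply/le_anti; rewrite andbC le_bjump //=.
  have Tr := bjump_in TS Tq; have [rtau|taur] := ltP (bjump T (fjump T (bjump T tau))) tau.
    exact: le_bjump.
  have {}taur : tau < bjump T (fjump T (bjump T tau)).
    by rewrite lt_neqAle taur neqT.
  have qr : fjump T tau <= bjump T (fjump T (bjump T tau)) by exact: fjump_le.
  have rE : bjump T (fjump T (bjump T tau)) = fjump T (bjump T tau).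
    by apply/le_anti; rewrite bjump_le /= -{1}qE.
  have as_ : a < fjump T (bjump T tau) by exact: lt_trans at' tq.
  have qt0 : 0 < fjump T (bjump T tau) - tau by rewrite subr_gt0.
  have [x [Tx x1 x2]] := left_dense TS as_ rE qt0.
  have taux : tau < x by lra.
  by have := fjump_le Tx taux; rewrite qE leNgt x2.
rewrite bjump_refl fjump_refl !opprK qE sE.
set s := bjump T tau in st tq sq *; set q := fjump T s in tq sq *.
by field; rewrite !(gt_eqF, lt_eqF) ?subr_gt0 //; lra.
Qed.

End Interpolation.

Section DirectionalDerivative.
Variables (R : realType) (T : set R) (a b : R).
Hypothesis TS : time_scale T a b.
Let TS' := time_scale_refl TS.
Implicit Types (f g : R -> R) (t d u : R).

Lemma bar_left_estimate f t d e : is_nabla T f t d -> 0 < e -> a < t ->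
  exists2 x, x < t & forall tau, x < tau -> tau < t ->
    `|bar T f tau - bar T f t - d * (tau - t)| <= e * (t - tau).
Proof.
move=> fd e0 at_; have Tt := kappa_dn_sub (proj1 fd).
have tb := ts_ub TS Tt; have ta := ts_lb TS Tt.
have tb' : - t < - a by rewrite ltrN2.
have [x tx hx] := bar_right_estimate TS' (proj1 (is_nabla_refl TS _ _ _) fd) e0 tb'.
exists (Num.max a (- x)); first by rewrite gt_max at_ ltrNl.
move=> tau; rewrite gt_max => /andP[atau xtau] taut.
have := hx (- tau); rewrite ltrN2 taut ltrNl xtau => /(_ isT isT).
rewrite !(bar_refl TS) ?(ltW atau) //; last exact: ltW (lt_le_trans taut tb).
rewrite (_ : - tau - - t = t - tau); last by ring.
by rewrite mulNr -mulrN opprB.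
Qed.

Lemma bar_limit (f : R -> R) (t u d : R) :
  (forall e, 0 < e -> \forall h \near 0^'+,
     `|bar T f (t + h * u) - bar T f t - d * (h * u)| <= e * h) ->
  (bar T f (t + h * u) - bar T f t) / h @[h --> 0^'+] --> u * d.
Proof.
move=> H; apply/cvgrPdist_le => e e0.
move: (H e e0) (nbhs_right_gt (0 : R)) => /filterS2; apply=> h hb h0.
have -> : u * d - (bar T f (t + h * u) - bar T f t) / h =
  - (bar T f (t + h * u) - bar T f t - d * (h * u)) / h.
  by field; rewrite gt_eqF.
by rewrite normrM normrN normfV (gtr0_norm h0) ler_pdivrMr.
Qed.

Lemma is_Dbar_delta f t u d : 0 < u -> is_delta T f t d ->
  is_Dbar T f t u (u * d).
Proof.
move=> u0 fd; have Tt := kappa_up_sub (proj1 fd).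
rewrite /is_Dbar; case: asboolP => [[ubt _]|nub]; first by exists d.
case: asboolP => [[_]|_]; first by rewrite ltNge ltW.
have tb : t < b.
  apply: (ts_lt_max TS Tt); apply/eqP => tb; apply: nub; split=> //.
  by rewrite tb; exact: ts_ub TS.
apply: bar_limit => e e0; have eu0 : 0 < e / u by rewrite divr_gt0.
have [x tx hx] := bar_right_estimate TS fd eu0 tb.
have r0 : 0 < (x - t) / u by rewrite divr_gt0 // subr_gt0.
near=> h.
have h0 : 0 < h by near: h; exact: nbhs_right_gt.
have : h < (x - t) / u by near: h; exact: nbhs_right_lt.
rewrite ltr_pdivlMr // => hux; have hu0 : 0 < h * u by rewrite mulr_gt0.
have := hx (t + h * u) _ _; have -> : t + h * u - t = h * u by ring.
have -> : e / u * (h * u) = e * h by field; rewrite gt_eqF.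
by apply; lra.
Unshelve. all: by end_near. Qed.

Lemma is_Dbar_nabla f t u d : u < 0 -> is_nabla T f t d ->
  is_Dbar T f t u (u * d).
Proof.
move=> u0 fd; have Tt := kappa_dn_sub (proj1 fd).
rewrite /is_Dbar; case: asboolP => [[_]|_]; first by rewrite ltNge ltW.
case: asboolP => [[lbt _]|nlb]; first by exists d.
have at_ : a < t.
  apply: (ts_gt_min TS Tt); apply/eqP => ta; apply: nlb; split=> //.
  by rewrite ta; exact: ts_lb TS.
have u0' : 0 < - u by rewrite oppr_gt0.
apply: bar_limit => e e0; have eu0 : 0 < e / - u by rewrite divr_gt0.
have [x tx hx] := bar_left_estimate fd eu0 at_.
have r0 : 0 < (t - x) / - u by rewrite divr_gt0 // subr_gt0.
near=> h.
have h0 : 0 < h by near: h; exact: nbhs_right_gt.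
have : h < (t - x) / - u by near: h; exact: nbhs_right_lt.
rewrite ltr_pdivlMr // => hux; have hu0 : 0 < h * - u by rewrite mulr_gt0.
have := hx (t + h * u) _ _; have -> : t - (t + h * u) = h * - u by ring.
have -> : t + h * u - t = h * u by ring.
have -> : e / - u * (h * - u) = e * h by field; rewrite lt_eqF.
by apply; lra.
Unshelve. all: by end_near. Qed.

Lemma is_Dbar_uniq f t u d1 d2 :
  (ubound T t -> 0 < u -> kappa_up T t) ->
  (lbound T t -> u < 0 -> kappa_dn T t) ->
  is_Dbar T f t u d1 -> is_Dbar T f t u d2 -> d1 = d2.
Proof.
move=> hu hl; rewrite /is_Dbar; case: asboolP => [[/hu/[apply] ku]|_].
  by move=> [d1' h1 ->] [d2' h2 ->]; rewrite (is_delta_uniq TS h1 h2).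
case: asboolP => [[/hl/[apply] kd]|_].
  by move=> [d1' h1 ->] [d2' h2 ->]; rewrite (is_nabla_uniq TS h1 h2).
by apply: cvg_unique; exact: Rhausdorff.
Qed.

Lemma Dbar_delta f t u d : 0 < u -> is_delta T f t d -> Dbar T f t u = u * d.
Proof.
move=> u0 fd; apply: xget_unique; first exact: is_Dbar_delta.
move=> d' hd'; apply: is_Dbar_uniq hd' (is_Dbar_delta u0 fd).
  by move=> _ _; case: fd.
by move=> _; rewrite ltNge ltW.
Qed.

Lemma Dbar_nabla f t u d : u < 0 -> is_nabla T f t d -> Dbar T f t u = u * d.
Proof.
move=> u0 fd; apply: xget_unique; first exact: is_Dbar_nabla.
move=> d' hd'; apply: is_Dbar_uniq hd' (is_Dbar_nabla u0 fd).
  by move=> _; rewrite ltNge ltW.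
by move=> _ _; case: fd.
Qed.

End DirectionalDerivative.

(** * The Euler-Lagrange equation for both signs of the direction *)

Section ReflectedIntegral.
Variables (R : realType) (T : set R) (a b : R).
Hypothesis TS : time_scale T a b.
Let TS' := time_scale_refl TS.
Implicit Types (f g y z w eta : R -> R) (t u : R).

Lemma delta_int_eq r s g1 g2 : (forall t, kappa_up T t -> g1 t = g2 t) ->
  delta_int T r s g1 = delta_int T r s g2.
Proof.
move=> g12; congr xget; apply/seteqP.
by split=> v [G hG ->]; exists G => // t kt; have := hG t kt; rewrite g12.
Qed.

Lemma nabla_antiderivative_refl f g :
  (forall t, kappa_dn T t -> is_nabla T f t (g t)) <->
  (forall t, kappa_up (refl T) t -> is_delta (refl T) (f \o -%R) t (- g (- t))).
Proof.
rewrite (kappa_up_refl TS); split=> h t kt.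
  by have /(is_nabla_refl TS) := h (- t) kt; rewrite opprK.
by apply/(is_nabla_refl TS); have := h (- t); rewrite /refl /= opprK; exact.
Qed.

(** Also true if there is no antiderivative, as both integrals are then 0. *)
Lemma nabla_int_refl g : nabla_int T a b g =
  - delta_int (refl T) (- b) (- a) (fun t => - g (- t)).
Proof.
have E f : (forall t, kappa_dn T t -> is_nabla T f t (g t)) ->
    delta_int (refl T) (- b) (- a) (fun t => - g (- t)) = f a - f b.
  by move=> /nabla_antiderivative_refl/(delta_intE TS') -> /=; rewrite !opprK.
have [[f fg]|nG] := pselect (exists f, forall t, kappa_dn T t -> is_nabla T f t (g t)).
  rewrite (E f fg) opprB; apply: xget_unique; first by exists f.
  move=> _ [h hg ->]; have := E h hg; rewrite (E f fg); lra.
rewrite /nabla_int /delta_int !xgetPN ?oppr0 //.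
  move=> v [f fg _]; apply: nG; exists (f \o -%R).
  apply/nabla_antiderivative_refl => t /fg.
  by congr is_delta; apply/funext => s /=; rewrite opprK.
by move=> v [f fg _]; apply: nG; exists f.
Qed.

Lemma C1_diamond_refl f : C1_diamond T f -> C1_diamond (refl T) (f \o -%R).
Proof.
move=> Cf; have refl_cont A g t : cont_at A g (- t) -> cont_at (refl A) (fun s => - g (- s)) t.
  move=> /cont_atP gc; apply/cont_atP => e /gc/near_distP[r r0 h].
  apply: filterS (near_dist_lt t r0) => s sr As; rewrite -opprD normrN.
  apply: h => //; by rewrite -opprD normrN.
have K : kappa_dn (refl T) = refl (kappa_up T).
  by rewrite -[X in refl (kappa_up X)](reflK T) (kappa_up_refl TS') reflK.
case: (Cf) => _ /within_contP dc _ /within_contP nc.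
apply: (C1_intro TS' (v := fun t => - nabla T f (- t))
                     (n := fun t => - delta T f (- t))).
- by apply/nabla_antiderivative_refl => t; exact: C1_nabla.
- by rewrite (kappa_up_refl TS); apply/within_contP => t kt; apply/refl_cont/nc.
- move=> t kt; apply/(is_nabla_refl TS'); rewrite reflK opprK.
  rewrite (_ : (f \o _) \o _ = f); last by apply/funext => s /=; rewrite opprK.
  by apply: C1_delta => //; move: kt; rewrite K.
- by rewrite K; apply/within_contP => t kt; apply/refl_cont/dc.
Qed.

End ReflectedIntegral.

Section Minimizers.
Variables (R : realType) (T : set R) (a b : R).
Hypothesis TS : time_scale T a b.
Let TS' := time_scale_refl TS.
Implicit Types (f g y z w eta : R -> R) (t u : R).

Lemma is_derive_neg2 (M : R -> R -> R -> R) (t x v : R) : lagrangian_C1 M ->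
  is_derive x 1 (fun s => - M (- t) s (- v)) (- partial2 M (- t) x (- v)).
Proof.
move=> [_ _ _ d2 _]; apply: is_deriveN.
by rewrite /partial2 derive1E; apply: derivableP.
Qed.

Lemma is_derive_neg3 (M : R -> R -> R -> R) (t x v : R) : lagrangian_C1 M ->
  is_derive v 1 (fun s => - M (- t) x (- s)) (partial3 M (- t) x (- v)).
Proof.
move=> [_ _ _ _ d3].
have h : is_derive (- v) 1 (fun s => M (- t) x s) (partial3 M (- t) x (- v)).
  by rewrite /partial3 derive1E; apply: derivableP.
have := is_deriveN (is_derive1_comp h (is_deriveN (is_derive_id v 1))).
by rewrite mulrN1 opprK.
Qed.

Lemma partial2_negE (M : R -> R -> R -> R) (t x v : R) : lagrangian_C1 M ->
  partial2 (fun t x v => - M (- t) x (- v)) t x v = - partial2 M (- t) x (- v).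
Proof.
by move=> CM; rewrite {1}/partial2 derive1E; exact/derive_val/is_derive_neg2.
Qed.

Lemma partial3_negE (M : R -> R -> R -> R) (t x v : R) : lagrangian_C1 M ->
  partial3 (fun t x v => - M (- t) x (- v)) t x v = partial3 M (- t) x (- v).
Proof.
by move=> CM; rewrite {1}/partial3 derive1E; exact/derive_val/is_derive_neg3.
Qed.

Lemma lagrangian_C1_neg (M : R -> R -> R -> R) : lagrangian_C1 M ->
  lagrangian_C1 (fun t x v => - M (- t) x (- v)).
Proof.
move=> CM; have [c c2 c3 _ _] := CM.
pose s (p : R * R * R) : R * R * R := (- p.1.1, p.1.2, - p.2).
have sc : continuous s.
  move=> p; apply: cvg_pair_at; last by apply: cvgN; exact: cvg_snd.
  apply: cvg_pair_at; first by apply: cvgN; apply: cvg_comp; [exact: cvg_fst|exact: cvg_fst].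
  by apply: cvg_comp; [exact: cvg_fst|exact: cvg_snd].
have E2 : uncurry3 (partial2 (fun t x v => - M (- t) x (- v))) =
          fun p => - uncurry3 (partial2 M) (s p).
  by apply/funext => p; rewrite /uncurry3 partial2_negE.
have E3 : uncurry3 (partial3 (fun t x v => - M (- t) x (- v))) =
          fun p => uncurry3 (partial3 M) (s p).
  by apply/funext => p; rewrite /uncurry3 partial3_negE.
have comp_s (f : R * R * R -> R) : continuous f -> continuous (f \o s).
  by move=> fc p; apply: continuous_comp; [exact: sc|exact: fc].
split.
- by move=> p; apply: cvgN; exact: (comp_s _ c).
- by rewrite E2 => p; apply: cvgN; exact: (comp_s _ c2).
- by rewrite E3 => p; exact: (comp_s _ c3).
- by move=> t x v; case: (is_derive_neg2 t x v CM).
- by move=> t x v; case: (is_derive_neg3 t x v CM).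
Qed.

Variables (L M : R -> R -> R -> R) (u alpha beta : R) (y : R -> R).
Hypothesis CM : lagrangian_C1 M.
Hypothesis LM : forall t x v, T t -> L t x v = M t x v.
Hypothesis y_min : weak_local_minimizer T L u a b alpha beta y.

Let Cy : C1_diamond T y. Proof. by case: y_min => -[]. Qed.

(** Dividing by [u] compensates the factor [u] of [comp_xi] and of the
    directional derivative. *)
Lemma minimizer_perturbation f : u != 0 -> C1_diamond T f ->
  f a = 0 -> f b = 0 -> exists2 r, 0 < r & forall c, `|c| < r ->
    C1_diamond T (fun t => y t + c / u * f t) /\
    functional T L u a b y <= functional T L u a b (fun t => y t + c / u * f t).
Proof.
move=> u0 Cf fa fb; have [[_ ya yb] [del del0 h]] := y_min.
have [r r0 hr] := C1_norm_small TS Cf del0.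
exists (r * `|u|); first by rewrite mulr_gt0 ?normr_gt0.
move=> c cr; have Cz : C1_diamond T (fun t => y t + c / u * f t) by exact: (C1_lin TS).
split=> //; apply: h; first by split; rewrite ?fa ?fb ?mulr0 ?addr0.
rewrite (_ : (fun t => _) = fun t => c / u * f t); last first.
  by apply/funext => t; rewrite addrAC subrr add0r.
by apply: hr; rewrite normrM normfV ltr_pdivrMr ?normr_gt0.
Qed.

Lemma functional_pos z : 0 < u -> C1_diamond T z ->
  functional T L u a b z = u * delta_int T a b
    (fun t => M t (u * z (fjump T t)) (u * delta T z t)).
Proof.
move=> u0 Cz; rewrite /functional /dir_int ltW //; congr (_ * _).
apply: delta_int_eq => t kt; rewrite LM; last exact: kappa_up_sub kt.
by rewrite (Dbar_delta TS u0 (C1_delta Cz kt)) /comp_xi /dir_jump ltW.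
Qed.

(** The sign of [u] and that of the reflected integral combine to the positive
    factor [- u] and the Lagrangian [- M]. *)
Lemma functional_neg z : u < 0 -> C1_diamond T z ->
  functional T L u a b z = - u * delta_int (refl T) (- b) (- a)
    (fun t => - M (- t) (u * z (- fjump (refl T) t)) (u * nabla T z (- t))).
Proof.
move=> u0 Cz; have uF : (0 <= u) = false by apply/negbTE; rewrite -ltNge.
rewrite /functional /dir_int uF (nabla_int_refl TS) mulrN -mulNr; congr (_ * _).
apply: delta_int_eq => t; rewrite (kappa_up_refl TS) => kt.
rewrite LM; last exact: kappa_dn_sub kt.
rewrite (Dbar_nabla TS u0 (C1_nabla Cz kt)) /comp_xi /dir_jump uF.
by have := fjump_refl T (- t); rewrite opprK => ->; rewrite opprK.
Qed.

Lemma euler_lagrange_pos : 0 < u -> exists G, forall t, kappa_up T t ->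
  is_delta T G t (partial2 M t (comp_xi T y u t) (Dbar T y t u)) /\
  partial3 M t (comp_xi T y u t) (Dbar T y t u) = G t.
Proof.
move=> u0; have rcst (c : R) : rd_cont T (fun=> c).
  by apply: (rd_within TS); case: (slope_cst T c).
have rX : rd_cont T (fun t => u * y (fjump T t)).
  by apply: (rd_mul TS) => //; apply/(rd_fjump TS)/(C1_cont TS Cy).
have rV : rd_cont T (fun t => u * delta T y t).
  by apply: (rd_mul TS) => //; apply: (rd_within_kappa TS); case: Cy.
have [|G hG] := euler_lagrange_integral TS CM rX rV.
  move=> w eta sw etap etaa etab.
  have [r r0 hr] := minimizer_perturbation (lt0r_neq0 u0) (slope_C1 TS sw etap) etaa etab.
  exists r => // c /hr[Cz]; rewrite !functional_pos // ler_pM2l //.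
  congr (_ <= _); apply: delta_int_eq => t kt; congr (M t _ _).
    by field; rewrite gt_eqF.
  rewrite (deltaE TS (is_delta_lin (c / u) (C1_delta Cy kt) (slope_delta TS sw etap kt))).
  by field; rewrite gt_eqF.
exists G => t kt; rewrite (Dbar_delta TS u0 (C1_delta Cy kt)).
by rewrite /comp_xi /dir_jump ltW //; exact: hG.
Qed.

(** On [refl T], the reflection of [y] minimizes the delta functional with
    Lagrangian [- M (- t) x (- v)]: the slopes change sign under
    reflection, the values of [y] do not. *)
Lemma euler_lagrange_neg : u < 0 -> exists G, forall t, kappa_dn T t ->
  is_nabla T G t (partial2 M t (comp_xi T y u t) (Dbar T y t u)) /\
  partial3 M t (comp_xi T y u t) (Dbar T y t u) = G t.
Proof.
move=> u0; have uF : (0 <= u) = false by apply/negbTE; rewrite -ltNge.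
have un0 : u != 0 by rewrite lt_eqF.
have CM' := lagrangian_C1_neg CM.
have Cy' := C1_diamond_refl TS Cy.
have rcst (c : R) : rd_cont (refl T) (fun=> c).
  by apply: (rd_within TS'); case: (slope_cst (refl T) c).
have rX : rd_cont (refl T) (fun t => u * (y \o -%R) (fjump (refl T) t)).
  by apply: (rd_mul TS') => //; apply/(rd_fjump TS')/(C1_cont TS' Cy').
have rV : rd_cont (refl T) (fun t => u * delta (refl T) (y \o -%R) t).
  by apply: (rd_mul TS') => //; apply: (rd_within_kappa TS'); case: Cy'.
have y'E t : kappa_up (refl T) t -> delta (refl T) (y \o -%R) t = - nabla T y (- t).
  rewrite (kappa_up_refl TS) => kt; apply: (deltaE TS').
  by have /(is_nabla_refl TS) := C1_nabla Cy kt; rewrite opprK.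
have [|G hG] := euler_lagrange_integral TS' CM' rX rV.
  move=> w eta sw etap etab etaa.
  have Ceta : C1_diamond T (eta \o -%R).
    by rewrite -[T]reflK; apply: (C1_diamond_refl TS'); exact: (slope_C1 TS' sw etap).
  have [r r0 hr] := minimizer_perturbation un0 Ceta etaa etab.
  exists r => // c /hr[Cz]; rewrite !functional_neg // ler_pM2l ?oppr_gt0 //.
  congr (_ <= _); apply: delta_int_eq => t kt; congr (- M (- t) _ _).
  - by rewrite y'E //; ring.
  - by rewrite /= opprK; field.
  - have kt' : kappa_dn T (- t) by move: kt; rewrite (kappa_up_refl TS).
    have etan : is_nabla T (eta \o -%R) (- t) (- w t).
      apply/(is_nabla_refl TS); rewrite !opprK.
      rewrite (_ : (eta \o _) \o _ = eta); first exact: (slope_delta TS' sw etap kt).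
      by apply/funext => s /=; rewrite opprK.
    rewrite (nablaE TS (is_nabla_lin TS (c / u) (C1_nabla Cy kt') etan)) y'E //.
    by field.
have EX t : kappa_dn T t -> u * (y \o -%R) (fjump (refl T) (- t)) = comp_xi T y u t.
  by move=> kt; rewrite /comp_xi /dir_jump uF /= fjump_refl opprK.
have EV t : kappa_dn T t -> - (u * delta (refl T) (y \o -%R) (- t)) = Dbar T y t u.
  move=> kt; rewrite y'E; last by rewrite (kappa_up_refl TS) /refl /= opprK.
  by rewrite opprK mulrN opprK (Dbar_nabla TS u0 (C1_nabla Cy kt)).
exists (G \o -%R) => t kt.
have [|Gd GE] := hG (- t); first by rewrite (kappa_up_refl TS) /refl /= opprK.
split.
  apply/(is_nabla_refl TS).
  rewrite (_ : (G \o _) \o _ = G); last by apply/funext => s /=; rewrite opprK.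
  congr is_delta: Gd.
  by rewrite partial2_negE // opprK EX // EV.
by rewrite /= -GE partial3_negE // opprK EX // EV.
Qed.

End Minimizers.

Theorem theorem23 (R : realType) (T : set R) (a b : R)
    (T_closed : closed T)
    (aT : T a) (a_inf : lbound T a) (bT : T b) (b_sup : ubound T b)
    (ab : a < b) (T_int : T `&` `]a, b[ !=set0)
    (L : R -> R -> R -> R) (L_smooth : smooth_on T L)
    (u alpha beta : R) (u_neq0 : u != 0)
    (y : R -> R) (y_min : weak_local_minimizer T L u a b alpha beta y) :
  let F := fun t => partial3 L t (comp_xi T y u t) (Dbar T y t u) in
  forall t : R,
    (kappa_up (kappa_up T) `&` kappa_dn (kappa_dn T)) t ->
    (* [F] is defined at the next point in the direction [u]: this fails only
       at t = rho b left-dense with rho b < b (u > 0), resp. t = sigma a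
       right-dense with a < sigma a (u < 0), where [bar T F] is undefined *)
    dir_kappa T u (dir_jump T u t) ->
    is_Dbar T F t u (u * partial2 L t (comp_xi T y u t) (Dbar T y t u)).
Proof.
move=> F t [[ku _] [kd _]]; rewrite /dir_kappa /dir_jump.
have TS : time_scale T a b by split.
have [M Msmooth LM] := L_smooth; have CM := smooth_lagrangian_C1 (Msmooth 1%N).
have FM s : T s -> F s = partial3 M s (comp_xi T y u s) (Dbar T y s u).
  move=> Ts; rewrite /F /partial3; congr (derive1 _ _).
  by apply/funext => v; exact: LM.
have -> : partial2 L t (comp_xi T y u t) (Dbar T y t u) =
          partial2 M t (comp_xi T y u t) (Dbar T y t u).
  rewrite /partial2; congr (derive1 _ _); apply/funext => x; apply: LM.
  exact: kappa_up_sub ku.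
have [u0|u0] := leP 0 u => kj.
  have u_gt0 : 0 < u by rewrite lt_neqAle eq_sym u_neq0.
  have [G hG] := euler_lagrange_pos TS CM LM y_min u_gt0.
  apply: (is_Dbar_delta TS u_gt0); apply: is_delta_eq (proj1 (hG t ku)) => //.
    exact: (near_kappa_up TS).
  by move=> s ks; rewrite FM ?(proj2 (hG s ks)) //; exact: kappa_up_sub ks.
have [G hG] := euler_lagrange_neg TS CM LM y_min u0.
apply: (is_Dbar_nabla TS u0); apply: (is_nabla_eq TS) (proj1 (hG t kd)) => //.
by move=> s ks; rewrite FM ?(proj2 (hG s ks)) //; exact: kappa_dn_sub ks.
Qed.
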